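(* Let $(X,d)$ be a proper metric space of bounded geometry that satisfies property A$'$, let $\mu$ be a Borel measure on $X$, $p\in(1,\infty)$, and let $A\in\mathcal{L}(L_p(X,\mu))$. Let $(\varphi_{j,t})_{j\in\mathbb{N},t>0}$ be the functions fixed in the context. Then the following are equivalent: (a) $A\in\mathrm{BDO}^p$. (b) $\displaystyle\lim_{t\to0}\ \sup_{\|f\|_p=1}\ \sum_{j=1}^\infty\|[A,M_{\varphi_{j,t}}]f\|_p^p=0$.
   Context: Let $(X,d)$ be a metric space; $B(x,r)$ denotes the open ball. $X$ is proper if closed balls are compact. $X$ has bounded geometry if there is $\varepsilon>0$ such that for all $r>0$ there is $N_r\in\mathbb{N}$ such that for all $x\in X$ the ball $B(x,r)$ can be covered by at most $N_r$ open balls of radius $\varepsilon$. A proper metric space $X$ of bounded geometry has property A$'$ if for every $t>0$ there is a countably infinite collection $(\varrho_{j,t})_{j\in\mathbb{N}}$ of non-zero measurable functions $\varrho_{j,t}\colon X\to[0,1]$ such that (i) $\sum_{j}\varrho_{j,t}(x)=1$ for all $x\in X$; (ii) $\sup_{j}\operatorname{diam}(\operatorname{spt}\varrho_{j,t})<\infty$, where $\operatorname{spt}$ denotes the support; (iii) $d(x,y)\le\frac1t$ implies $\sum_{j}|\varrho_{j,t}(x)-\varrho_{j,t}(y)|<t$; (iv) for all $x\in X$, $s>0$ the set $\{j:\operatorname{spt}\varrho_{j,t}\cap B(x,s)\neq\varnothing\}$ is finite. For every $t>0$ one such family $(\varrho_{j,t})_{j\in\mathbb{N}}$ is fixed, and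 $\varphi_{j,t}:=\varrho_{j,t}^{1/p}$. $L_p(X,\mu)$ is complex-valued, $\mathcal{L}(E)$ denotes the bounded operators on a Banach space $E$, $M_f$ is multiplication by $f$, $\mathbf{1}_K$ the indicator function of a measurable set $K$, and $[A,B]=AB-BA$. For $A\in\mathcal{L}(L_p(X,\mu))$, $\operatorname{prop}(A):=\sup\{\operatorname{dist}(K,K'):K,K'\subseteq X\text{ measurable},\ M_{\mathbf{1}_{K'}}AM_{\mathbf{1}_K}\neq0\}\in[0,\infty]$, where $\operatorname{dist}(K,K')=\inf_{x\in K,y\in K'}d(x,y)$. $\mathrm{BO}:=\{A:\operatorname{prop}(A)<\infty\}$ (band operators), and $\mathrm{BDO}^p:=\overline{\mathrm{BO}}$ (operator-norm closure) is the set of band-dominated operators. *)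

(* Defs.v *)
From HB Require Import structures.
From mathcomp Require Import all_boot all_order all_algebra.
From mathcomp Require Import ring_quotient.
From mathcomp Require Import all_classical all_reals all_analysis.
From mathcomp Require Import measurable_realfun complex.

Set Implicit Arguments.
Unset Strict Implicit.
Unset Printing Implicit Defensive.

Import Order.TTheory GRing.Theory Num.Theory.
Import numFieldNormedType.Exports.

Local Open Scope classical_set_scope.
Local Open Scope ring_scope.

Import Normc.

Section complex_Lnorm.
Context d (T : measurableType d) (R : realType).
Variables (mu : {measure set T -> \bar R}) (p : R).

Definition measurable_cfun (f : T -> R[i]) :=
  measurable_fun [set: T] (fun x => complex.Re (f x)) /\
  measurable_fun [set: T] (fun x => complex.Im (f x)).

Definition cLnorm (f : T -> R[i]) : \bar R :=
  Lnorm mu p%:E (fun x => (normc (f x))%:E).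

Lemma normcE2 (z : R[i]) :
  normc z = Num.sqrt ((complex.Re z) ^+ 2 + (complex.Im z) ^+ 2).
Proof. by case: z. Qed.

Lemma normc_ge0 (z : R[i]) : 0 <= normc z.
Proof. by rewrite normcE2 sqrtr_ge0. Qed.

Lemma measurable_normc (f : T -> R[i]) :
  measurable_cfun f -> measurable_fun [set: T] (fun x => normc (f x)).
Proof.
move=> [mr mi]; rewrite (_ : (fun _ => _) =
  (@Num.sqrt R) \o (fun x => complex.Re (f x) ^+ 2 + complex.Im (f x) ^+ 2)).
  apply: measurableT_comp.
    apply: continuous_measurable_fun; exact: sqrt_continuous.
  by apply: measurable_funD; apply: measurable_funX.
by apply/funext => x /=; rewrite normcE2.
Qed.

Lemma measurable_cfunD (f g : T -> R[i]) :
  measurable_cfun f -> measurable_cfun g -> measurable_cfun (f + g).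
Proof.
move=> [fr fi] [gr gi]; split.
- rewrite (_ : (fun _ => _) =
    (fun x => complex.Re (f x)) \+ (fun x => complex.Re (g x))).
    exact: measurable_funD.
  by apply/funext => x /=; rewrite -!raddfD.
- rewrite (_ : (fun _ => _) =
    (fun x => complex.Im (f x)) \+ (fun x => complex.Im (g x))).
    exact: measurable_funD.
  by apply/funext => x /=; rewrite -!raddfD.
Qed.

Lemma measurable_cfunM (f g : T -> R[i]) :
  measurable_cfun f -> measurable_cfun g ->
  measurable_cfun (fun x => f x * g x).
Proof.
move=> [fr fi] [gr gi]; split.
- rewrite (_ : (fun _ => _) = (fun x =>
    complex.Re (f x) * complex.Re (g x) - complex.Im (f x) * complex.Im (g x))).
    by apply: measurable_funB; apply: measurable_funM.
  by apply/funext => x; case: (f x); case: (g x).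
- rewrite (_ : (fun _ => _) = (fun x =>
    complex.Re (f x) * complex.Im (g x) + complex.Im (f x) * complex.Re (g x))).
    by apply: measurable_funD; apply: measurable_funM.
  by apply/funext => x; case: (f x); case: (g x).
Qed.

Lemma measurable_cfun_cst (c : R[i]) : measurable_cfun (cst c).
Proof. by split; exact: measurable_cst. Qed.

Hypothesis p1 : 1 <= p.

Let p0 : 0 < p. Proof. exact: lt_le_trans p1. Qed.

Lemma le_cLnorm (f : T -> R[i]) (g : T -> R) :
  (forall x, 0 <= g x) ->
  measurable_cfun f -> measurable_fun [set: T] g ->
  (forall x, normc (f x) <= g x) ->
  (cLnorm f <= Lnorm mu p%:E (fun x => (g x)%:E))%E.
Proof.
move=> g0 mf mg fg; rewrite /cLnorm unlock /Lnorm.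
have mpow (h : T -> R) : measurable_fun [set: T] h ->
    measurable_fun [set: T] (fun x => (`|(h x)%:E| `^ p)%E).
  move=> mh; apply: (@measurableT_comp _ _ _ _ _ _ (fun y => poweR y p)).
    exact: measurable_poweR.
  by apply: measurableT_comp => //; apply/measurable_EFinP.
apply: gt0_ler_poweR; rewrite ?invr_ge0 ?(ltW p0)//.
- by rewrite in_itv/= leey andbT; apply: integral_ge0 => x _; rewrite lee_fin powR_ge0.
- by rewrite in_itv/= leey andbT; apply: integral_ge0 => x _; rewrite lee_fin powR_ge0.
apply: ge0_le_integral => //.
- by move=> x _; exact: poweR_ge0.
- by apply: mpow; exact: measurable_normc.
- exact: mpow.
- move=> x _; apply: gt0_ler_poweR; rewrite ?(ltW p0)// ?in_itv/= ?leey ?andbT ?abse_ge0//.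
  by rewrite /= lee_fin !ger0_norm ?normc_ge0.
Qed.

Lemma cLnormZ (c : R) (g : T -> R) :
  measurable_fun [set: T] g -> (0 <= c) ->
  (Lnorm mu p%:E (fun x => (c * g x)%:E) =
   c%:E * Lnorm mu p%:E (fun x => (g x)%:E))%E.
Proof.
move=> mg c0; rewrite unlock /Lnorm.
transitivity ((\int[mu]_x ((c `^ p)%:E * `|(g x)%:E| `^ p)) `^ p^-1)%E.
  congr poweR; apply: eq_integral => x _.
  by rewrite EFinM abseM poweRM ?abse_ge0// gee0_abs ?lee_fin.
rewrite ge0_integralZl//.
- rewrite poweRM ?lee_fin ?powR_ge0//; last first.
    by apply: integral_ge0 => x _; exact: poweR_ge0.
  by rewrite poweR_EFin -powRrM mulfV ?gt_eqF// powRr1.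
- apply: (@measurableT_comp _ _ _ _ _ _ (fun y => poweR y p)).
    exact: measurable_poweR.
  by apply: measurableT_comp => //; apply/measurable_EFinP.
- by move=> x _; exact: poweR_ge0.
- by rewrite lee_fin powR_ge0.
Qed.

Lemma cLnormD (f g : T -> R[i]) : measurable_cfun f -> measurable_cfun g ->
  (cLnorm (f + g)%R <= cLnorm f + cLnorm g)%E.
Proof.
move=> mf mg.
apply: le_trans; last first.
  apply: (@eminkowski _ _ _ mu (fun x => normc (f x)) (fun x => normc (g x)));
    [exact: measurable_normc..|by rewrite lee_fin].
apply: le_cLnorm.
- by move=> x; rewrite addr_ge0 ?normc_ge0.
- exact: measurable_cfunD.
- by apply: measurable_funD; exact: measurable_normc.
- by move=> x; exact: le_normcD.
Qed.

Lemma cLnorm_scale (c : R[i]) (f : T -> R[i]) : measurable_cfun f ->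
  cLnorm (fun x => c * f x) = ((normc c)%:E * cLnorm f)%E.
Proof.
move=> mf; rewrite /cLnorm -cLnormZ ?normc_ge0//; last exact: measurable_normc.
by apply: eq_Lnorm => x; rewrite normcM.
Qed.

Lemma cLnorm0 : cLnorm 0 = 0%E.
Proof.
rewrite /cLnorm; under eq_Lnorm do rewrite normc0.
by rewrite Lnorm0// eqe gt_eqF.
Qed.

Lemma cLnorm_ge0 (f : T -> R[i]) : (0 <= cLnorm f)%E.
Proof. exact: Lnorm_ge0. Qed.

Lemma cLnorm_ae_eq (f g : T -> R[i]) : measurable_cfun f -> measurable_cfun g ->
  {ae mu, forall x, f x = g x} -> cLnorm f = cLnorm g.
Proof.
move=> mf mg fg; rewrite /cLnorm unlock /Lnorm; congr poweR.
have mpow (h : T -> R[i]) : measurable_cfun h ->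
    measurable_fun [set: T] (fun x => (`|(normc (h x))%:E| `^ p)%E).
  move=> mh; apply: (@measurableT_comp _ _ _ _ _ _ (fun y => poweR y p)).
    exact: measurable_poweR.
  by apply: measurableT_comp => //; apply/measurable_EFinP/measurable_normc.
apply: ge0_ae_eq_integral => //; try exact: mpow.
- by move=> x _; exact: poweR_ge0.
- by move=> x _; exact: poweR_ge0.
- by apply: filterS fg => x + _; move=> ->.
Qed.

End complex_Lnorm.

Section complex_Lfun.
Context d (T : measurableType d) (R : realType).
Variables (mu : {measure set T -> \bar R}) (p : R) (p1 : 1 <= p).

(* The unused proof of [1 <= p] lets the vector space structures below be
   inferred, as in the library's [LfunType]. *)
Definition cLfun of (1 <= p) : {pred T -> R[i]} :=
  mem [set f | measurable_cfun f /\ (cLnorm mu p f < +oo)%E].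

Lemma cLfunP (f : T -> R[i]) :
  f \in cLfun p1 <-> measurable_cfun f /\ (cLnorm mu p f < +oo)%E.
Proof. by rewrite inE. Qed.

Lemma cLfun_submod_closed : submod_closed (cLfun p1).
Proof.
split.
  apply/cLfunP; split; first exact: measurable_cfun_cst.
  by rewrite cLnorm0// ltry.
move=> a f g /cLfunP[mf lf] /cLfunP[mg lg].
have maf : measurable_cfun (fun x => a * f x).
  by apply: measurable_cfunM => //; exact: measurable_cfun_cst.
apply/cLfunP; split; first exact: (@measurable_cfunD _ _ _ (fun x => a * f x)).
apply: (le_lt_trans (@cLnormD _ _ _ mu p p1 (fun x => a * f x) g maf mg)).
rewrite lte_add_pinfty// cLnorm_scale// lte_mul_pinfty ?lee_fin ?normc_ge0//.
Qed.

HB.instance Definition _ :=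
  GRing.isSubmodClosed.Build _ _ (cLfun p1) cLfun_submod_closed.

Record cLfunType := CLfunType {
  cLfun_val :> T -> R[i] ;
  cLfun_valP : cLfun_val \in cLfun p1 }.

HB.instance Definition _ := [isSub for cLfun_val].
HB.instance Definition _ := [Choice of cLfunType by <:].
HB.instance Definition _ := [SubChoice_isSubLmodule of cLfunType by <:].

Definition cLnull : {pred cLfunType} :=
  mem [set f : cLfunType | {ae mu, forall x, f x = 0}].

Lemma cLnullP (f : cLfunType) :
  f \in cLnull <-> {ae mu, forall x, f x = 0}.
Proof. by rewrite inE. Qed.

Lemma cLfun_valB (f g : cLfunType) x : (f - g) x = f x - g x.
Proof. by []. Qed.

Lemma cLfun_valD (f g : cLfunType) x : (f + g) x = f x + g x.
Proof. by []. Qed.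

Lemma cLfun_valZ a (f : cLfunType) x : (a *: f) x = a * f x.
Proof. by []. Qed.

Lemma cLnull_zmod_closed : zmod_closed cLnull.
Proof.
split; first by apply/cLnullP; apply: aeW => x.
move=> f g /cLnullP f0 /cLnullP g0; apply/cLnullP.
by apply: filterS2 f0 g0 => x fx gx; rewrite cLfun_valB fx gx subrr.
Qed.

HB.instance Definition _ :=
  GRing.isZmodClosed.Build _ cLnull cLnull_zmod_closed.

End complex_Lfun.
Arguments cLfun {d T R} mu {p} p1.
Arguments cLnull {d T R} mu {p} p1.

Section complex_Lp.
Context d (T : measurableType d) (R : realType).
Variables (mu : {measure set T -> \bar R}) (p : R) (p1 : 1 <= p).
Local Open Scope quotient_scope.

Definition cLp := Quotient.quot (cLnull mu p1).
HB.instance Definition _ := GRing.Zmodule.on cLp.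
HB.instance Definition _ := EqQuotient.on cLp.

Lemma cLp_eqP (f g : cLfunType mu p1) :
  \pi_cLp f = \pi_cLp g <-> {ae mu, forall x, f x = g x}.
Proof.
have -> : (\pi_cLp f = \pi_cLp g) <-> (f - g \in cLnull mu p1).
  by rewrite Quotient.idealrBE; split => /eqP.
rewrite cLnullP; split; apply: filterS => x; rewrite cLfun_valB.
  by move=> /eqP; rewrite subr_eq0 => /eqP.
by move=> ->; rewrite subrr.
Qed.

Lemma repr_piE (f : cLfunType mu p1) :
  {ae mu, forall x, repr (\pi_cLp f) x = f x}.
Proof. by apply/cLp_eqP; rewrite reprK. Qed.

Definition cLp_scale (a : R[i]) (u : cLp) : cLp := \pi_cLp (a *: repr u).

Lemma cLp_piZ a f : cLp_scale a (\pi_cLp f) = \pi_cLp (a *: f).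
Proof.
apply/cLp_eqP; apply: filterS (repr_piE f) => x fx.
by rewrite !cLfun_valZ fx.
Qed.

Lemma cLp_piD f g : \pi_cLp f + \pi_cLp g = \pi_cLp (f + g).
Proof. by have /esym := Quotient.pi_add (cLnull mu p1) f g. Qed.

Lemma cLp_scaleA a b u : cLp_scale a (cLp_scale b u) = cLp_scale (a * b) u.
Proof. by elim/quotW: u => u; rewrite (cLp_piZ b u) !cLp_piZ scalerA. Qed.

Lemma cLp_scale1 : left_id 1 cLp_scale.
Proof. by elim/quotW => u; rewrite cLp_piZ scale1r. Qed.

Lemma cLp_scaleDr : right_distributive cLp_scale +%R.
Proof.
move=> a; elim/quotW => u; elim/quotW => v.
by rewrite cLp_piD !cLp_piZ cLp_piD scalerDr.
Qed.

Lemma cLp_scaleDl u : {morph cLp_scale^~ u : a b / a + b}.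
Proof.
by elim/quotW: u => u a b; rewrite !cLp_piZ cLp_piD scalerDl.
Qed.

HB.instance Definition _ := GRing.Zmodule_isLmodule.Build R[i] cLp
  cLp_scaleA cLp_scale1 cLp_scaleDr cLp_scaleDl.

Lemma cLfun_measurable (f : cLfunType mu p1) : measurable_cfun f.
Proof. by have /cLfunP[] := cLfun_valP f. Qed.

Lemma cLfun_finite (f : cLfunType mu p1) : cLnorm mu p f \is a fin_num.
Proof. by have /cLfunP[_] := cLfun_valP f; rewrite ge0_fin_numE ?cLnorm_ge0. Qed.

Definition cLp_norm (u : cLp) : R := fine (cLnorm mu p (repr u)).

Lemma cLp_norm_pi f : cLp_norm (\pi_cLp f) = fine (cLnorm mu p f).
Proof.
congr fine; apply: cLnorm_ae_eq; [exact: cLfun_measurable..|exact: repr_piE].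
Qed.

Lemma ler_cLp_normD u v : cLp_norm (u + v) <= cLp_norm u + cLp_norm v.
Proof.
elim/quotW: u => u; elim/quotW: v => v; rewrite cLp_piD !cLp_norm_pi -fineD ?cLfun_finite//.
rewrite fine_le ?fin_numD ?cLfun_finite//.
rewrite (_ : cLfun_val _ = (u : T -> _) + (v : T -> _)); last first.
  by apply/funext => x; rewrite cLfun_valD.
by apply: cLnormD => //; exact: cLfun_measurable.
Qed.

Lemma cLp_normZ (a : R[i]) u : cLp_norm (a *: u) = normc a * cLp_norm u.
Proof.
elim/quotW: u => u; rewrite [a *: _]cLp_piZ !cLp_norm_pi.
rewrite (_ : cLfun_val _ = (fun x => a * u x)); last first.
  by apply/funext => x; rewrite cLfun_valZ.
rewrite cLnorm_scale//; last exact: cLfun_measurable.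
by rewrite fineM ?cLfun_finite.
Qed.

Lemma cLp_pi0 : \pi_cLp 0 = 0.
Proof. by apply: (addrI (\pi_cLp 0)); rewrite cLp_piD !addr0. Qed.

Lemma cLp_norm0_eq0 u : cLp_norm u = 0 -> u = 0.
Proof.
elim/quotW: u => u; rewrite cLp_norm_pi => u0.
rewrite -cLp_pi0; apply/cLp_eqP.
have Nu0 : cLnorm mu p u = 0%E by rewrite -(fineK (cLfun_finite _)) u0.
have mu0 : measurable_fun [set: T] (fun x => (normc (u x))%:E).
  by apply/measurable_EFinP/measurable_normc/cLfun_measurable.
have p0 : (0 < p%:E)%E by rewrite lte_fin (lt_le_trans _ p1).
apply: filterS (Lnorm_eq0_eq0 mu0 p0 Nu0) => x /(_ I)[].
exact: eq0_normc.
Qed.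

Lemma cLp_normMn u n : cLp_norm (u *+ n) = cLp_norm u *+ n.
Proof.
rewrite -scaler_nat cLp_normZ -[RHS]mulr_natl; congr (_ * _).
by rewrite normcMn normc1.
Qed.

Lemma cLp_normN u : cLp_norm (- u) = cLp_norm u.
Proof. by rewrite -scaleN1r cLp_normZ normcN normc1 mul1r. Qed.

(* [cLp] is a vector space over [R[i]] whose norm takes its values in [R]. *)
HB.instance Definition _ := Num.Zmodule_isNormed.Build R cLp
  ler_cLp_normD cLp_norm0_eq0 cLp_normMn cLp_normN.

End complex_Lp.

Section operators.
Context d (T : measurableType d) (R : realType).
Variables (mu : {measure set T -> \bar R}) (p : R) (p1 : 1 <= p).
Local Open Scope quotient_scope.
Local Notation L := (cLp mu p1).

(* [mulop f] is M_f for f bounded and measurable, see [mulopE]; for other f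
   the junk value 0 is taken whenever f * u is not p-integrable. *)
Definition mulop (f : T -> R[i]) (u : L) : L :=
  \pi_L (insubd (0 : cLfunType mu p1) (fun x => f x * repr u x)).

Lemma mulopE (f : T -> R[i]) (M : R) (u : L) :
  measurable_cfun f -> (forall x, normc (f x) <= M) ->
  {ae mu, forall x, repr (mulop f u) x = f x * repr u x}.
Proof.
move=> mf fM; have mu_ := cLfun_measurable (repr u).
have mfu : measurable_cfun (fun x => f x * repr u x).
  exact: measurable_cfunM.
have lfu : (fun x => f x * repr u x) \in cLfun mu p1.
  apply/cLfunP; split => //.
  have M0 : 0 <= M by rewrite (le_trans _ (fM point))// normc_ge0.
  apply: (@le_lt_trans _ _ (M%:E * cLnorm mu p (repr u))%E).
    rewrite /cLnorm -cLnormZ//; last exact: measurable_normc.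
    apply: le_cLnorm => //.
    - by move=> x; rewrite mulr_ge0// normc_ge0.
    - by apply: measurable_funM => //; exact: measurable_normc.
    - by move=> x; rewrite normcM ler_wpM2r// normc_ge0.
  by rewrite lte_mul_pinfty ?lee_fin// ltey_eq cLfun_finite.
have := repr_piE (insubd (0 : cLfunType mu p1) (fun x => f x * repr u x)).
by rewrite -[X in {ae mu, forall x, _ = X x}]/(\val _) insubdK.
Qed.

(* supremum in [0, +oo]: the empty set has supremum 0 *)
Definition nneg_sup (S : set (\bar R)) : \bar R := ereal_sup (0%E |` S).

Definition opnorm (A : L -> L) : \bar R :=
  nneg_sup [set `|A f|%:E | f in [set f | `|f| <= 1]].

Definition bounded_operator (A : {linear L -> L}) := (opnorm A < +oo)%E.

Definition commutator (A B : L -> L) : L -> L := (A \o B) \- (B \o A).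

Definition mulop_indic (K : set T) : L -> L :=
  mulop (fun x => (\1_K x : R)%:C%C).

End operators.

(* The library's measurable types are pointed. The empty space is excluded by
   [property_A'] anyway, since its functions are nonzero. *)
#[short(type="pmetricType")]
HB.structure Definition PMetric (K : numDomainType) :=
  { M of Metric K M & Pointed M }.

Definition borel (R : realType) (X : pmetricType R) :=
  g_sigma_algebraType (@open X).
HB.instance Definition _ (R : realType) (X : pmetricType R) :=
  Measurable.on (borel X).

Section metric.
Context {R : realType} (X : pmetricType R).

(* The library's [closed_ball] is the closure of the open ball, which may be
   smaller than the closed ball. *)
Definition proper_space :=
  forall (x : X) (r : R), compact [set y | mdist x y <= r].

Definition bounded_geometry := exists2 eps : R, 0 < eps &
  forall r : R, 0 < r -> exists N : nat, forall x : X, exists s : seq X,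
    (size s <= N)%N /\ ball x r `<=` \bigcup_(y in [set` s]) ball y eps.

Definition diam (S : set X) : \bar R :=
  nneg_sup [set (mdist xy.1 xy.2)%:E | xy in S `*` S].

Definition setdist (K K' : set X) : \bar R :=
  ereal_inf [set (mdist xy.1 xy.2)%:E | xy in K `*` K'].

Definition spt (f : X -> R) : set X := closure [set x | f x != 0].

Record A'_family (t : R) (rho : nat -> X -> R) : Prop := {
  A'_measurable : forall j, measurable_fun [set: borel X] (rho j) ;
  A'_ge0 : forall j x, 0 <= rho j x ;
  A'_le1 : forall j x, rho j x <= 1 ;
  A'_neq0 : forall j, exists x, rho j x != 0 ;
  A'_sum1 : forall x, (\sum_(j <oo) (rho j x)%:E = 1)%E ;
  A'_diam : (nneg_sup [set diam (spt (rho j)) | j in [set: nat]] < +oo)%E ;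
  A'_variation : forall x y, mdist x y <= t^-1 ->
    (\sum_(j <oo) `|rho j x - rho j y|%:E < t%:E)%E ;
  A'_locally_finite : forall x s, 0 < s ->
    finite_set [set j | spt (rho j) `&` ball x s !=set0] }.

Definition property_A' := forall t : R, 0 < t -> exists rho, A'_family t rho.

End metric.

Section band_dominated.
Context {R : realType} {X : pmetricType R}.
Variables (mu : {measure set (borel X) -> \bar R}) (p : R) (p1 : 1 <= p).
Local Notation L := (cLp mu p1).

Definition propagation (A : L -> L) : \bar R :=
  nneg_sup [set r | exists K K' : set (borel X),
    [/\ measurable K, measurable K',
        mulop_indic K' \o A \o mulop_indic K <> (fun=> 0) &
        r = setdist K K']].

Definition BO : set {linear L -> L} :=
  [set A | bounded_operator A /\ (propagation A < +oo)%E].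

Definition BDO : set {linear L -> L} :=
  [set A | bounded_operator A /\
    forall e : R, 0 < e -> exists2 B, BO B & (opnorm (A \- B)%R < e%:E)%E].

End band_dominated.

(* Main.v *)
Require Import Defs.
From HB Require Import structures.
From mathcomp Require Import all_boot all_order all_algebra.
From mathcomp Require Import all_classical all_reals all_analysis.
From mathcomp Require Import measurable_realfun complex ring.
Set Implicit Arguments.
Unset Strict Implicit.
Unset Printing Implicit Defensive.
Import Order.TTheory GRing.Theory Num.Theory.
Import numFieldNormedType.Exports.
Local Open Scope classical_set_scope.
Local Open Scope ring_scope.
Import Normc.

(** The proof compares the commutators of A with the multiplications by the
    p-th roots phi_j of a partition of unity rho_j that varies by at most t at
    distances up to 1/t. Everything rests on one identity, valid at each point
    and then integrated: the sum of the phi_j ^ p is 1, so the L^p norms of the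
    pieces phi_j u recombine to the norm of u in the l^p sense.

    If A is band-dominated, write A = (A - B) + B with B a band operator and
    A - B small. The identity bounds the p-th power sum of the commutators of
    A - B by a multiple of the p-th power of its norm ([commutator_series_le]).
    For B it is of order t ([BO_commutator_le]): bounded geometry gives a cover
    by balls of one radius, still of finite multiplicity after any enlargement
    ([bounded_geometry_net]). Seen from one ball, B only acts on a slightly
    larger ball, on which the functions phi_j are constant up to errors whose
    p-th powers sum to at most t, because |a ^ (1/p) - b ^ (1/p)| ^ p <= |a - b|
    ([powR_root_dist]); and constants commute with B.

    Conversely, the operator S u = sum of phi_j ^ (p - 1) A (phi_j u) is a band
    operator since the supports have uniformly bounded diameter. It differs from
    A by minus the sum of the phi_j ^ (p - 1) [A, phi_j], and by Hoelder's
    inequality with the weights phi_j ^ (p - 1), whose conjugate powers sum to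
    1, the p-th power of the norm of (A - S) u is at most the p-th power sum of
    the norms of [A, phi_j] u ([band_approximation]). The sum defining S is
    locally finite, so it can be formed at each point ([glue]). *)

(** * Inequalities for real powers *)

Section real_inequalities.
Variable R : realType.
Implicit Types a b p u v : R.

Lemma powR_superadd p u v : 1 <= p -> 0 <= u -> 0 <= v ->
  u `^ p + v `^ p <= (u + v) `^ p.
Proof.
move=> p1 u0 v0.
have p0 : 0 < p by exact: lt_le_trans p1.
have uv0 : 0 <= u + v by rewrite addr_ge0.
have q0 : 0 <= p - 1 by rewrite subr_ge0.
rewrite -[u `^ p]mulr_powRB1// -[v `^ p]mulr_powRB1// -[leRHS]mulr_powRB1// mulrDl.
apply: lerD; apply: ler_wpM2l => //; apply: ge0_ler_powR;
  rewrite ?nnegrE ?lerDl ?lerDr//.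
Qed.

(** With x and y the p-th roots of a >= b, superadditivity applied to
    x = (x - y) + y gives (x - y) ^ p + y ^ p <= x ^ p. This turns the l^1
    variation bound on a partition of unity into an l^p bound on its p-th
    roots. *)
Lemma powR_root_dist p a b : 1 <= p -> 0 <= a -> 0 <= b ->
  `|a `^ p^-1 - b `^ p^-1| `^ p <= `|a - b|.
Proof.
move=> p1; have p0 : 0 < p by exact: lt_le_trans p1.
wlog ab : a b / b <= a.
  move=> H a0 b0; case: (leP b a) => [ba|/ltW ab]; first exact: H.
  by rewrite distrC [leRHS]distrC; exact: H.
move=> a0 b0; set x := a `^ _; set y := b `^ _.
have xp : x `^ p = a by rewrite -powRrM mulVf ?gt_eqF// powRr1.
have yp : y `^ p = b by rewrite -powRrM mulVf ?gt_eqF// powRr1.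
have yx : y <= x by apply: ge0_ler_powR; rewrite ?nnegrE ?invr_ge0 ?(ltW p0).
rewrite !ger0_norm ?subr_ge0// -xp -yp lerBrDr.
apply: (le_trans (powR_superadd p1 _ _)); rewrite ?subr_ge0 ?powR_ge0//.
by rewrite subrK.
Qed.

(** A crude form of the convexity inequality: a + b is at most twice the larger
    of the two numbers. *)
Lemma powRD_le p a b : 0 <= p -> 0 <= a -> 0 <= b ->
  (a + b) `^ p <= 2 `^ p * (a `^ p + b `^ p).
Proof.
move=> p0; wlog ab : a b / a <= b.
  move=> H a0 b0; case: (leP a b) => [ab|/ltW ba]; first exact: H.
  by rewrite addrC [in leRHS]addrC; exact: H.
move=> a0 b0; apply: (@le_trans _ _ ((2 * b) `^ p)).
  apply: ge0_ler_powR; rewrite ?nnegrE ?addr_ge0 ?mulr_ge0//.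
  by rewrite mulr_natl mulr2n lerD2r.
by rewrite powRM// ler_wpM2l ?powR_ge0// lerDr powR_ge0.
Qed.

Lemma ler_powR_inv p a b : 0 < p -> 0 <= a -> 0 <= b ->
  a `^ p <= b `^ p -> a <= b.
Proof.
move=> p0 a0 b0; apply: contraTT; rewrite -!ltNge => ba.
by apply: gt0_ltr_powR; rewrite ?nnegrE.
Qed.

(** Hoelder's inequality for the vectors w ^ (1 - 1/p) and h: the conjugate
    exponent of p is 1 / (1 - 1/p), so the first vector has norm at most 1. It is
    what makes the recombination of a partition by the conjugate powers a
    contraction. *)
Lemma weighted_hoelder p (I : Type) (r : seq I) (w h : I -> R) : 1 < p ->
  (forall i, 0 <= w i) -> (forall i, 0 <= h i) -> \sum_(i <- r) w i <= 1 ->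
  (\sum_(i <- r) w i `^ (1 - p^-1) * h i) `^ p <= \sum_(i <- r) h i `^ p.
Proof.
move=> p1 w0 h0 w1.
have p0 : 0 < p by exact: lt_trans p1.
set s := \sum_(i <- r) h i `^ p.
have s0 : 0 <= s by apply: sumr_ge0 => i _; exact: powR_ge0.
have q0 : 0 < 1 - p^-1 by rewrite subr_gt0 invf_lt1.
have wh0 i : 0 <= w i `^ (1 - p^-1) * h i by rewrite mulr_ge0 ?powR_ge0.
pose H := s `^ p^-1.
have HE : H `^ p = s by rewrite -powRrM mulVf ?gt_eqF// powRr1.
have H0 : 0 <= H by exact: powR_ge0.
suff : \sum_(i <- r) w i `^ (1 - p^-1) * h i <= H.
  move=> sH; rewrite -HE ge0_ler_powR ?nnegrE ?(ltW p0)//.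
  exact: sumr_ge0.
suff youngs e : H < e -> \sum_(i <- r) w i `^ (1 - p^-1) * h i <= e.
  by apply/ler_addgt0Pr => e e0; apply: youngs; rewrite ltrDl.
move=> He; have e0 : 0 < e by exact: le_lt_trans He.
(* Young's inequality after dividing h by e; a number e above the l^p norm of h
   stands for that norm, which may vanish *)
have young i : w i `^ (1 - p^-1) * (h i / e) <=
    w i * (1 - p^-1) + h i `^ p / e `^ p * p^-1.
  have wE : (w i `^ (1 - p^-1)) `^ (1 - p^-1)^-1 = w i.
    by rewrite -powRrM mulfV ?gt_eqF// powRr1.
  have hE : (h i / e) `^ p = h i `^ p / e `^ p.
    by rewrite powRM ?invr_ge0 ?(ltW e0)// -[e^-1]powR_inv1 ?(ltW e0)// powRAC powR_inv1 ?powR_ge0.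
  have := @conjugate_powR _ (w i `^ (1 - p^-1)) (h i / e) (1 - p^-1)^-1 p.
  rewrite wE hE invrK; apply; rewrite ?powR_ge0 ?invr_gt0 ?subrK//.
  by rewrite divr_ge0 ?(ltW e0).
rewrite -[leRHS]mul1r -ler_pdivrMr// mulr_suml.
apply: (@le_trans _ _ (\sum_(i <- r) (w i * (1 - p^-1) + h i `^ p / e `^ p * p^-1))).
  by apply: ler_sum => i _; apply: le_trans (young i); rewrite mulrA.
rewrite big_split/= -!mulr_suml -/s.
have se : s / e `^ p <= 1.
  rewrite ler_pdivrMr ?powR_gt0// mul1r -HE.
  by rewrite ge0_ler_powR ?nnegrE ?(ltW p0) ?(ltW e0) ?(ltW He).
rewrite -[leRHS](subrK p^-1); apply: lerD.
  by rewrite ler_piMl ?(ltW q0).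
by rewrite ler_piMl ?invr_ge0 ?(ltW p0).
Qed.

End real_inequalities.

(** * Multiplication operators on L^p *)

Section multipliers.
Context d (T : measurableType d) (R : realType).
Variables (mu : {measure set T -> \bar R}) (p : R) (p1 : 1 <= p).
Local Open Scope quotient_scope.
Local Notation L := (cLp mu p1).
Implicit Types (u v : L) (f g : T -> R[i]).

Let p0 : 0 < p. Proof. exact: lt_le_trans p1. Qed.

Lemma cLp_ext u v : {ae mu, forall x, repr u x = repr v x} -> u = v.
Proof. by move=> /cLp_eqP; rewrite !reprK. Qed.

Lemma cLp_reprD u v : {ae mu, forall x, repr (u + v) x = repr u x + repr v x}.
Proof.
have uvE : u + v = \pi_L (repr u + repr v) by rewrite -cLp_piD !reprK.
apply: filterS (repr_piE (repr u + repr v)) => x.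
by rewrite -uvE cLfun_valD.
Qed.

Lemma cLp_reprZ (a : R[i]) u : {ae mu, forall x, repr (a *: u) x = a * repr u x}.
Proof.
by apply: filterS (repr_piE (a *: repr u)) => x; rewrite cLfun_valZ.
Qed.

Lemma cLp_repr0 : {ae mu, forall x, repr (0 : L) x = 0}.
Proof.
by apply: filterS (repr_piE (0 : cLfunType mu p1)) => x; rewrite cLp_pi0.
Qed.

Lemma measurable_normcX f : measurable_cfun f ->
  measurable_fun [set: T] (fun x => (normc (f x) `^ p)%:E).
Proof.
move=> mf; apply/measurable_EFinP.
apply: (@measurableT_comp _ _ _ _ _ _ (fun y : R => y `^ p)).
  exact: measurable_powR.
exact: measurable_normc.
Qed.

Lemma measurable_repr u : measurable_cfun (repr u).
Proof. exact: cLfun_measurable. Qed.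

Lemma cLp_normX u :
  (`|u| `^ p)%:E = (\int[mu]_x (normc (repr u x) `^ p)%:E)%E.
Proof.
have fu := cLfun_finite (repr u).
rewrite -[`|u|]/(fine (cLnorm mu p (repr u))).
have -> : ((fine (cLnorm mu p (repr u))) `^ p)%:E = (cLnorm mu p (repr u) `^ p)%E.
  by rewrite -{2}(fineK fu) poweR_EFin.
have pN0 : p != 0 by rewrite gt_eqF.
rewrite /cLnorm (poweR_Lnorm _ _ pN0).
by apply: eq_integral => x _; rewrite poweR_EFin ger0_norm ?normc_ge0.
Qed.

Lemma cLp_normX_ae u f : measurable_cfun f ->
  {ae mu, forall x, repr u x = f x} ->
  (`|u| `^ p)%:E = (\int[mu]_x (normc (f x) `^ p)%:E)%E.
Proof.
move=> mf uf; rewrite cLp_normX; apply: ge0_ae_eq_integral => //.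
- exact/measurable_normcX/measurable_repr.
- exact: measurable_normcX.
- by move=> x _; rewrite lee_fin powR_ge0.
- by move=> x _; rewrite lee_fin powR_ge0.
- by apply: filterS uf => x -> _.
Qed.

Definition multiplier f :=
  measurable_cfun f /\ exists M : R, forall x, normc (f x) <= M.

Lemma repr_mulop f u : multiplier f ->
  {ae mu, forall x, repr (mulop f u) x = f x * repr u x}.
Proof. by move=> [mf [M fM]]; exact: mulopE fM. Qed.

Lemma multiplier_cst c : multiplier (cst c).
Proof. by split; [exact: measurable_cfun_cst|exists (normc c)]. Qed.

Lemma multiplierD f g : multiplier f -> multiplier g ->
  multiplier (fun x => f x + g x).
Proof.
move=> [mf [M fM]] [mg [N gN]]; split; first exact: measurable_cfunD.
exists (M + N) => x; apply: (le_trans (le_normcD _ _)).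
by rewrite lerD.
Qed.

Lemma multiplierM f g : multiplier f -> multiplier g ->
  multiplier (fun x => f x * g x).
Proof.
move=> [mf [M fM]] [mg [N gN]]; split; first exact: measurable_cfunM.
exists (M * N) => x; rewrite normcM.
by rewrite ler_pM ?normc_ge0.
Qed.

Lemma multiplier_real (g : T -> R) (M : R) : measurable_fun [set: T] g ->
  (forall x, `|g x| <= M) -> multiplier (fun x => (g x)%:C%C).
Proof.
move=> mg gM; split; first by split => //=; exact: measurable_cst.
by exists M => x; rewrite /= expr0n addr0 sqrtr_sqr.
Qed.

Lemma normc_real (x : R) : normc (x%:C%C) = `|x|.
Proof. by rewrite /= expr0n addr0 sqrtr_sqr. Qed.

Lemma multiplier_indic (K : set T) : measurable K ->
  multiplier (fun x => (\1_K x : R)%:C%C).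
Proof.
move=> mK; apply: (@multiplier_real _ 1) => // x.
by rewrite ger0_norm// indicE; case: (_ \in _).
Qed.

Lemma mulop_cst (c : R[i]) u : mulop (cst c) u = c *: u.
Proof.
apply: cLp_ext; move: (repr_mulop u (multiplier_cst c)) (cLp_reprZ c u).
by apply: filterS2 => x -> ->.
Qed.

Lemma mulopDr f u v : multiplier f -> mulop f (u + v) = mulop f u + mulop f v.
Proof.
move=> mf; apply: cLp_ext.
near=> x; have -> : repr (mulop f (u + v)) x = f x * repr (u + v) x.
  by near: x; exact: repr_mulop.
have -> : repr (u + v) x = repr u x + repr v x by near: x; exact: cLp_reprD.
have -> : repr (mulop f u + mulop f v) x =
    repr (mulop f u) x + repr (mulop f v) x.
  by near: x; exact: cLp_reprD.
have -> : repr (mulop f u) x = f x * repr u x by near: x; exact: repr_mulop.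
have -> : repr (mulop f v) x = f x * repr v x by near: x; exact: repr_mulop.
by rewrite mulrDr.
Unshelve. all: by end_near. Qed.

Lemma mulopDl f g u : multiplier f -> multiplier g ->
  mulop (fun x => f x + g x) u = mulop f u + mulop g u.
Proof.
move=> mf mg; apply: cLp_ext; near=> x.
have -> : repr (mulop (fun x => f x + g x) u) x = (f x + g x) * repr u x.
  by near: x; apply: repr_mulop; exact: multiplierD.
have -> : repr (mulop f u + mulop g u) x =
    repr (mulop f u) x + repr (mulop g u) x.
  by near: x; exact: cLp_reprD.
have -> : repr (mulop f u) x = f x * repr u x by near: x; exact: repr_mulop.
have -> : repr (mulop g u) x = g x * repr u x by near: x; exact: repr_mulop.
by rewrite mulrDl.
Unshelve. all: by end_near. Qed.

Lemma mulopM f g u : multiplier f -> multiplier g ->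
  mulop f (mulop g u) = mulop (fun x => f x * g x) u.
Proof.
move=> mf mg; apply: cLp_ext; near=> x.
have -> : repr (mulop (fun x => f x * g x) u) x = f x * g x * repr u x.
  by near: x; apply: repr_mulop; exact: multiplierM.
have -> : repr (mulop f (mulop g u)) x = f x * repr (mulop g u) x.
  by near: x; exact: repr_mulop.
have -> : repr (mulop g u) x = g x * repr u x by near: x; exact: repr_mulop.
by rewrite mulrA.
Unshelve. all: by end_near. Qed.

Lemma mulopZr f c u : multiplier f -> mulop f (c *: u) = c *: mulop f u.
Proof.
move=> mf; rewrite -!mulop_cst !mulopM//; last 2 first.
- exact: multiplier_cst.
- exact: multiplier_cst.
by congr mulop; apply/funext => x; rewrite mulrC.
Qed.

Lemma mulopNr f u : multiplier f -> mulop f (- u) = - mulop f u.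
Proof. by move=> mf; rewrite -[- u]scaleN1r mulopZr// scaleN1r. Qed.

Lemma mulopBr f u v : multiplier f -> mulop f (u - v) = mulop f u - mulop f v.
Proof. by move=> mf; rewrite mulopDr// mulopNr. Qed.

Lemma mulop_indicD_setC (K : set T) u : measurable K ->
  mulop_indic K u + mulop_indic (~` K) u = u.
Proof.
move=> mK; have mK' : measurable (~` K) by exact: measurableC.
rewrite /mulop_indic -mulopDl; try exact: multiplier_indic.
rewrite -[RHS]scale1r -mulop_cst; congr mulop; apply/funext => x.
by rewrite !indicE in_setC; case: (_ \in _); rewrite ?addr0 ?add0r.
Qed.

Lemma mulop_eq0 f u : (forall x, f x = 0) -> mulop f u = 0.
Proof.
by move=> f0; rewrite (_ : f = cst 0) ?mulop_cst ?scale0r//; exact/funext.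
Qed.

Lemma normX_mulop f u : multiplier f ->
  (`|mulop f u| `^ p)%:E =
  (\int[mu]_x ((normc (f x) `^ p)%:E * (normc (repr u x) `^ p)%:E))%E.
Proof.
move=> mf; rewrite (@cLp_normX_ae _ (fun x => f x * repr u x)).
- by apply: eq_integral => x _; rewrite normcM powRM ?normc_ge0// EFinM.
- by apply: measurable_cfunM; [case: mf|exact: measurable_repr].
- exact: repr_mulop.
Qed.

Let measurable_summand f u : multiplier f -> measurable_fun [set: T]
  (fun x => ((normc (f x) `^ p)%:E * (normc (repr u x) `^ p)%:E)%E).
Proof.
move=> [mf _]; apply: emeasurable_funM; first exact: measurable_normcX.
exact/measurable_normcX/measurable_repr.
Qed.

Let normcX_ge0 (z : R[i]) : (0 <= (normc z `^ p)%:E)%E.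
Proof. by rewrite lee_fin powR_ge0. Qed.

(** The p-th powers of the norms of multiplications add up pointwise under the
    integral. All orthogonality used below has this form: the l^p sum of a
    family of cut-offs of u is controlled by the multiplicity of the cut-offs. *)
Lemma sum_normX_mulop_le (f : nat -> T -> R[i]) (C : R) u n :
  (forall j, multiplier (f j)) ->
  (forall x, \sum_(j < n) normc (f j x) `^ p <= C) ->
  \sum_(j < n) `|mulop (f j) u| `^ p <= C * `|u| `^ p.
Proof.
move=> mf fC; rewrite -lee_fin EFinM cLp_normX -sumEFin.
have C0 : 0 <= C.
  by apply: le_trans (fC point); apply: sumr_ge0 => j _; exact: powR_ge0.
under eq_bigr do rewrite normX_mulop//.
rewrite -ge0_integral_sum//; last first.
- by move=> j x _; rewrite mule_ge0.
- by move=> j; exact: measurable_summand.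
rewrite -ge0_integralZl//; last exact/measurable_normcX/measurable_repr.
apply: ge0_le_integral => //.
- by move=> x _; apply: sume_ge0 => j _; rewrite mule_ge0.
- by apply: emeasurable_sum => j; exact: measurable_summand.
- by apply: measurable_funeM; exact/measurable_normcX/measurable_repr.
- move=> x _; rewrite -ge0_sume_distrl//; apply: lee_wpmul2r => //.
  by rewrite sumEFin lee_fin.
Qed.

Lemma norm_mulop_le f u : multiplier f -> (forall x, normc (f x) <= 1) ->
  `|mulop f u| <= `|u|.
Proof.
move=> mf f1; apply: (ler_powR_inv p0) => //.
have := @sum_normX_mulop_le (fun=> f) 1 u 1 (fun=> mf).
rewrite big_ord1 mul1r; apply => x; rewrite big_ord1.
have -> : 1 = 1 `^ p :> R by rewrite powR1.
by apply: ge0_ler_powR; rewrite ?nnegrE ?normc_ge0 ?(ltW p0).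
Qed.

Lemma nneseries_ub (a : nat -> R) (C : \bar R) : (forall j, 0 <= a j) ->
  (forall n, ((\sum_(j < n) a j)%:E <= C)%E) -> (\sum_(j <oo) (a j)%:E <= C)%E.
Proof.
move=> a0 aC; apply: lime_le; first by apply: is_cvg_nneseries => j _ _; rewrite lee_fin.
by apply: nearW => n; rewrite big_mkord sumEFin.
Qed.

Lemma nneseries_lb (a : nat -> R) n : (forall j, 0 <= a j) ->
  ((\sum_(j < n) a j)%:E <= \sum_(j <oo) (a j)%:E)%E.
Proof.
move=> a0; rewrite -sumEFin -(big_mkord xpredT (fun j => (a j)%:E)).
by apply: nneseries_lim_ge => j _; rewrite lee_fin.
Qed.

(** The converse estimate, for cut-offs that together cover the space. *)
Lemma series_normX_mulop_ge (f : nat -> T -> R[i]) u :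
  (forall j, multiplier (f j)) ->
  (forall x, exists j, 1 <= normc (f j x)) ->
  ((`|u| `^ p)%:E <= \sum_(j <oo) (`|mulop (f j) u| `^ p)%:E)%E.
Proof.
move=> mf f1; rewrite cLp_normX.
under eq_eseriesr do rewrite normX_mulop//.
rewrite -integral_nneseries//; last first.
- by move=> j x _; rewrite mule_ge0.
- by move=> j; exact: measurable_summand.
have s0 x j : (0 <= (normc (f j x) `^ p)%:E * (normc (repr u x) `^ p)%:E)%E.
  by rewrite mule_ge0.
apply: ge0_le_integral => //.
- exact/measurable_normcX/measurable_repr.
- by apply: ge0_emeasurable_sum => // j _; exact: measurable_summand.
- move=> x _; have [j fj] := f1 x.
  apply: (@le_trans _ _
      ((normc (f j x) `^ p)%:E * (normc (repr u x) `^ p)%:E)%E).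
    rewrite -EFinM lee_fin ler_peMl ?powR_ge0//.
    by rewrite -(powRr0 (normc (f j x))) ler_powR// ltW.
  apply: le_trans (nneseries_lim_ge j.+1 _); last by [].
  rewrite big_nat_recr//= leeDr//.
  by apply: sume_ge0 => i _.
Qed.

End multipliers.

(** * Operator bounds and separated nets *)

Section bounded_operators.
Context d (T : measurableType d) (R : realType).
Variables (mu : {measure set T -> \bar R}) (p : R) (p1 : 1 <= p).
Local Notation L := (cLp mu p1).

Lemma nneg_sup_le (S : set (\bar R)) (c : \bar R) :
  (nneg_sup S <= c)%E <-> (0 <= c)%E /\ forall s, S s -> (s <= c)%E.
Proof.
split=> [Sc|[c0 Sc]].
  split=> [|s Ss]; apply: le_trans Sc; apply: ereal_sup_ubound; first by left.
  by right.
by apply: ge_ereal_sup => s [->//|]; exact: Sc.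
Qed.

Lemma nneg_sup_ge0 (S : set (\bar R)) : (0 <= nneg_sup S)%E.
Proof. by apply: ereal_sup_ubound; left. Qed.

Lemma nneg_sup_ub (S : set (\bar R)) s : S s -> (s <= nneg_sup S)%E.
Proof. by move=> Ss; apply: ereal_sup_ubound; right. Qed.

Lemma cLp_normZ_real (a : R) (u : L) : `|a%:C%C *: u| = `|a| * `|u|.
Proof. by rewrite -normc_real; exact: cLp_normZ. Qed.

Lemma linear_unit_norm_le (A : {linear L -> L}) (b : R) :
  (forall u, `|u| = 1 -> `|A u| <= b) -> forall u, `|A u| <= b * `|u|.
Proof.
move=> Ab u.
have [->|u0] := eqVneq u 0; first by rewrite linear0 !normr0 mulr0.
have nu : 0 < `|u| by rewrite normr_gt0.
have : `|A ((`|u|^-1)%:C%C *: u)| <= b.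
  by apply: Ab; rewrite cLp_normZ_real ger0_norm ?invr_ge0// mulVf// gt_eqF.
rewrite linearZ/= cLp_normZ_real ger0_norm ?invr_ge0//.
by rewrite mulrC ler_pdivrMr.
Qed.

Lemma opnorm_leP (A : {linear L -> L}) (b : R) :
  (opnorm A <= b%:E)%E <-> 0 <= b /\ forall u, `|A u| <= b * `|u|.
Proof.
split=> [/nneg_sup_le[]|[b0 Ab]].
  rewrite lee_fin => b0 Ab; split=> //; apply: linear_unit_norm_le => u u1.
  by rewrite -lee_fin; apply: Ab; exists u => //=; rewrite u1.
apply/nneg_sup_le; split; first by rewrite lee_fin.
move=> _ [u /= u1 <-]; rewrite lee_fin (le_trans (Ab u))//.
by rewrite ler_piMr.
Qed.

Lemma bounded_operatorP (A : {linear L -> L}) :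
  bounded_operator A <-> exists2 b, 0 <= b & forall u, `|A u| <= b * `|u|.
Proof.
split=> [Aoo|[b b0 Ab]]; last first.
  by apply: (@le_lt_trans _ _ b%:E); [apply/opnorm_leP|rewrite ltry].
have : opnorm A \is a fin_num by rewrite ge0_fin_numE// nneg_sup_ge0.
move=> /fineK Ae; have /opnorm_leP[b0 Ab] : (opnorm A <= (fine (opnorm A))%:E)%E.
  by rewrite Ae.
by exists (fine (opnorm A)).
Qed.

End bounded_operators.

Section bounded_geometry_net.
Context {R : realType} (X : pmetricType R).

Section greedy.
Variables (q : nat -> X) (s : R).

(** A maximal [s]-separated subfamily of [q], obtained without choice: whether
    an index is kept depends on the smaller kept ones only. *)
Fixpoint greedy_prefix n : seq nat :=
  if n is m.+1 then
    let l := greedy_prefix m in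
    if all (fun i => s <= mdist (q i) (q m)) l then m :: l else l
  else [::].

Definition greedy_net n := n \in greedy_prefix n.+1.

Let greedy_netE n i : (i \in greedy_prefix n) = (i < n)%N && greedy_net i.
Proof.
elim: n => [//|n IHn].
have [->|ni] := eqVneq i n; first by rewrite ltnS leqnn.
rewrite ltnS leq_eqVlt (negPf ni)/= -IHn.
by case: ifP => // _; rewrite inE (negPf ni).
Qed.

Lemma greedy_net_separated i j : greedy_net i -> greedy_net j -> i != j ->
  s <= mdist (q i) (q j).
Proof.
have H m n : greedy_net m -> greedy_net n -> (m < n)%N ->
    s <= mdist (q m) (q n).
  move=> gm; rewrite /greedy_net/=; case: ifP => [/allP al _ mn|_].
    by apply: al; rewrite greedy_netE mn.
  by rewrite greedy_netE ltnn.
move=> gi gj; rewrite neq_ltn => /orP[|] ij; first exact: H.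
by rewrite metric_sym; exact: H.
Qed.

Lemma greedy_net_dense : 0 < s -> forall n,
  exists2 i, greedy_net i & mdist (q i) (q n) < s.
Proof.
move=> s0 n; have [gn|gn] := boolP (greedy_net n).
  by exists n => //; rewrite mdistxx.
move: gn; rewrite /greedy_net/=; case: ifPn => [_|nall _]; first by rewrite mem_head.
have [j] := elimT allPn nall.
by rewrite greedy_netE -ltNge => /andP[_ gj] ?; exists j.
Qed.

End greedy.

(** A cover of the space by countably many balls of one radius such that the
    balls with the same centres and any other radius have bounded multiplicity.
    The centres are a greedily chosen 2 eps-separated subfamily of a countable
    family of eps-dense points; a ball of radius eps contains at most one of
    them, so the bound on the number of eps-balls covering a larger ball bounds
    the number of centres in it. *)
Lemma bounded_geometry_net : bounded_geometry X ->
  exists (r0 : R) (c : nat -> X) (D : pred nat), [/\ 0 < r0,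
    forall x, exists2 k, D k & mdist (c k) x < r0 &
    forall r : R, 0 < r -> exists N : nat, forall x n,
      (size [seq k <- iota 0 n | D k && (mdist (c k) x < r)%R] <= N)%N].
Proof.
move=> [eps eps0 bg].
have [F FP] : {F : nat -> seq X & forall n : nat,
    ball (point : X) n.+1%:R `<=` \bigcup_(y in [set` F n]) ball y eps}.
  suff /choice[F FP] : forall n : nat, exists l : seq X,
    ball (point : X) n.+1%:R `<=` \bigcup_(y in [set` l]) ball y eps.
    by exists F.
  move=> n; have [N /(_ point)[l [_ bl]]] := bg n.+1%:R (ltr0Sn _ _).
  by exists l.
(* a countable eps-dense family: the covers of the balls around one point with
   integer radius, enumerated together *)
pose q k := if unpickle k is Some (m, i) then nth point (F m) i else point.
have qP x : exists k, mdist (q k) x < eps.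
  pose n := Num.truncn (mdist point x).
  have : ball (point : X) n.+1%:R x.
    by rewrite ballEmdist/=; exact: truncnS_gt.
  move=> /FP[y /= yF]; rewrite ballEmdist/= => yx.
  by exists (pickle (n, index y (F n))); rewrite /q pickleK nth_index.
pose s := 2 * eps; have s0 : 0 < s by rewrite mulr_gt0.
exists (3 * eps), q, (greedy_net q s); split.
- by rewrite mulr_gt0.
- move=> x; have [k kx] := qP x.
  have [i gi ik] := greedy_net_dense q s0 k.
  exists i => //; apply: (le_lt_trans (metric_triangle _ (q k) _)).
  by rewrite (_ : 3 * eps = s + eps) ?ltrD// /s; ring.
move=> r r0; have [N NP] := bg r r0; exists N => x n.
set l := [seq _ <- _ | _].
have [S [SN Scov]] := NP x; apply: leq_trans SN.
have lP k : k \in l -> greedy_net q s k /\ exists2 y, y \in S & mdist y (q k) < eps.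
  rewrite mem_filter => /andP[/andP[gk kx] _]; split=> //.
  have : ball x r (q k) by rewrite ballEmdist/= metric_sym.
  by move=> /Scov[y /= yS]; rewrite ballEmdist => ky; exists y.
(* a separated set meets each ball of the small radius in at most one point *)
pose near k i := mdist (nth point S i) (q k) < eps.
pose f k := find (near k) (iota 0 (size S)).
have hasf k : k \in l -> has (near k) (iota 0 (size S)).
  move=> /lP[_ [y yS yk]]; apply/hasP; exists (index y S).
    by rewrite mem_iota/= index_mem.
  by rewrite /near nth_index.
have fP k : k \in l -> near k (f k) /\ (f k < size S)%N.
  move=> /hasf hk; have := nth_find 0%N hk.
  move: hk; rewrite has_find size_iota -/(f k) => fS.
  by rewrite nth_iota// add0n.
have uf : uniq (map f l).
  rewrite map_inj_in_uniq ?filter_uniq ?iota_uniq// => k k' kl k'l ff.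
  apply/eqP; apply: contraT => kk'.
  have [gk _] := lP _ kl; have [gk' _] := lP _ k'l.
  have := greedy_net_separated gk gk' kk'.
  have [nk _] := fP _ kl; have [nk' _] := fP _ k'l.
  rewrite leNgt => /negP[]; apply: (le_lt_trans (metric_triangle _ (nth point S (f k)) _)).
  rewrite /s mulr_natl mulr2n; apply: ltrD; first by rewrite metric_sym.
  by rewrite ff.
rewrite -(size_map f) -(size_iota 0 (size S)); apply: uniq_leq_size => //.
by move=> _ /mapP[k kl ->]; rewrite mem_iota/= add0n; have [] := fP _ kl.
Qed.

End bounded_geometry_net.

(** * Commutators of band operators *)

Section partition_multipliers.
Context {R : realType} {X : pmetricType R}.
Variables (p : R) (p1 : 1 <= p) (t : R) (rho : nat -> X -> R).
Hypothesis rhoP : A'_family t rho.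

Let p0 : 0 < p. Proof. exact: lt_le_trans p1. Qed.

Lemma A'_psum_le1 n x : \sum_(j < n) rho j x <= 1.
Proof.
rewrite -lee_fin -(A'_sum1 rhoP x); apply: nneseries_lb => j.
exact: (A'_ge0 rhoP).
Qed.

Lemma multiplier_powR_partition (s : R) : 0 <= s ->
  forall j, multiplier (fun x : borel X => (rho j x `^ s)%:C%C).
Proof.
move=> s0 j; apply: (@multiplier_real _ _ _ _ 1).
  apply: (@measurableT_comp _ _ _ _ _ _ (fun y : R => y `^ s)).
    exact: measurable_powR.
  exact: (A'_measurable rhoP).
move=> x; rewrite ger0_norm ?powR_ge0//.
have -> : 1 = 1 `^ s by rewrite powR1.
apply: ge0_ler_powR => //; rewrite ?nnegrE//.
  exact: (A'_ge0 rhoP).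
exact: (A'_le1 rhoP).
Qed.

Lemma sum_normcX_root_partition n x :
  \sum_(j < n) normc ((rho j x `^ p^-1)%:C%C) `^ p <= 1.
Proof.
apply: le_trans (A'_psum_le1 n x); apply: ler_sum => j _.
rewrite normc_real ger0_norm ?powR_ge0// -powRrM mulVf ?gt_eqF// powRr1//.
exact: (A'_ge0 rhoP).
Qed.

Lemma root_partition_variation n x y : mdist x y <= t^-1 ->
  \sum_(j < n) `|rho j x `^ p^-1 - rho j y `^ p^-1| `^ p <= t.
Proof.
move=> /(A'_variation rhoP)/ltW xyt.
apply: (@le_trans _ _ (\sum_(j < n) `|rho j x - rho j y|)).
  by apply: ler_sum => j _; apply: powR_root_dist => //; exact: (A'_ge0 rhoP).
rewrite -lee_fin; apply: le_trans xyt.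
exact: (@nneseries_lb _ (fun j => `|rho j x - rho j y|)).
Qed.

End partition_multipliers.

Section band_operators.
Context {R : realType} {X : pmetricType R}.
Variables (mu : {measure set (borel X) -> \bar R}) (p : R) (p1 : 1 <= p).
Local Notation L := (cLp mu p1).
Implicit Types (u : L).

Let p0 : 0 < p. Proof. exact: lt_le_trans p1. Qed.

Lemma setdist_ge (K K' : set X) (r : R) :
  (forall x y, K x -> K' y -> r <= mdist x y) -> (r%:E <= setdist K K')%E.
Proof.
move=> KK'; apply: le_ereal_inf_tmp => _ [[x y] [/= Kx K'y] <-].
by rewrite lee_fin; exact: KK'.
Qed.

(** Finite propagation in the form in which it is used. The distance [r] is one
    more than the propagation, because the cut-down operator need not vanish
    when the distance of the two sets equals the propagation. *)
Lemma BO_local (B : {linear L -> L}) : BO B -> exists2 r : R, 0 <= r &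
  forall K K' : set (borel X), measurable K -> measurable K' ->
    (forall x y, K x -> K' y -> r <= mdist x y) ->
    forall u, mulop_indic K' (B (mulop_indic K u)) = 0.
Proof.
move=> [_ Boo].
have Bge0 : (0 <= propagation B)%E := nneg_sup_ge0 _.
have : propagation B \is a fin_num by rewrite ge0_fin_numE.
move=> /fineK Be; exists (fine (propagation B) + 1).
  by rewrite addr_ge0// fine_ge0.
move=> K K' mK mK' KK' u; apply/eqP; apply: contraT => KBK'.
have : (setdist K K' <= propagation B)%E.
  apply: nneg_sup_ub; exists K, K'; split=> // /(congr1 (fun F => F u))/= E.
  by rewrite E eqxx in KBK'.
have := setdist_ge KK'; rewrite leNgt => /negP dK dB; exfalso; apply: dK.
by apply: (le_lt_trans dB); rewrite -Be lte_fin ltrDl.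
Qed.

Lemma measurable_mball (x : X) (r : R) :
  measurable ([set y | mdist x y < r] : set (borel X)).
Proof.
apply: sub_sigma_algebra; rewrite openE => y /= xy.
apply/nbhs_ballP; exists (r - mdist x y); first by rewrite /= subr_gt0.
move=> z; rewrite ballEmdist/= => yz.
by apply: (le_lt_trans (metric_triangle _ y _)); rewrite -ltrBrDl.
Qed.


(** The commutator of a band operator B with the p-th roots of a partition of
    unity is of order t. Near the ball of centre c_k each root phi_j may be
    replaced by psi = phi_j - phi_j(c_k), since constants commute with B; the
    finite propagation of B confines the whole expression to a larger ball N_k,
    where the sum over j of psi ^ p is at most t. The bounded multiplicity of
    the balls N_k allows one to sum over k. *)
Lemma BO_commutator_le (B : {linear L -> L}) : bounded_geometry X -> BO B ->
  exists K t0 : R, [/\ 0 <= K, 0 < t0 &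
    forall t rho, 0 < t -> t <= t0 -> A'_family t rho -> forall u,
    (\sum_(j <oo) (`|commutator B
       (mulop (fun x : borel X => (rho j x `^ p^-1)%:C%C)) u| `^ p)%:E <=
     (K * t * `|u| `^ p)%:E)%E].
Proof.
move=> /bounded_geometry_net[r0 [c [D [r0_gt0 cov mult]]]] BB.
have [r r_ge0 Bloc] := BO_local BB.
have [b b0 Bb] : exists2 b, 0 <= b & forall u, `|B u| <= b * `|u|.
  by apply/bounded_operatorP; case: BB.
pose V (s : R) k : set (borel X) := [set y | D k /\ mdist (c k) y < s].
have mV s k : measurable (V s k).
  have [Dk|Dk] := boolP (D k).
    rewrite (_ : V s k = ([set y | mdist (c k) y < s] : set X)).
      exact: measurable_mball.
    by apply/funext => y; apply/propext; split=> // -[].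
  rewrite (_ : V s k = set0)//; apply/funext => y; apply/propext; split=> // -[].
  by rewrite (negPf Dk).
have multV (s : R) : 0 < s -> exists2 N : R, 0 <= N & forall x n,
    \sum_(k < n) normc ((\1_(V s k) x : R)%:C%C) `^ p <= N.
  move=> s0; have [N NP] := mult s s0; exists N%:R => // x n.
  apply: le_trans (_ : (size [seq k <- iota 0 n | D k && (mdist (c k) x < s)])%:R <= _); last first.
    by rewrite ler_nat.
  rewrite -(big_mkord xpredT (fun k => normc ((\1_(V s k) x : R)%:C%C) `^ p)).
  rewrite size_filter -sum1_count natr_sum [leRHS]big_mkcond /index_iota subn0.
  apply: ler_sum => k _; rewrite normc_real indicE.
  case: ifPn => kx.
    by case: (_ \in _); rewrite ?normr0 ?normr1 ?powR1 ?powR0 ?gt_eqF.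
  rewrite memNset ?normr0 ?powR0 ?gt_eqF// => -[Dk xk].
  by rewrite Dk xk in kx.
have r1_gt0 : 0 < r0 + r by rewrite ltr_wpDr.
have [M1 M1_ge0 M1P] := multV _ r1_gt0.
have [M2 M2_ge0 M2P] := multV _ r0_gt0.
(* M1 counts the enlarged balls, M2 the balls themselves *)
pose K := 2 `^ p * (b `^ p * M1 + M2 * b `^ p).
exists K, (r0 + r)^-1; split.
- by rewrite mulr_ge0 ?powR_ge0// addr_ge0 ?mulr_ge0 ?powR_ge0.
- by rewrite invr_gt0.
move=> t rho t0 tt0 rhoP u.
pose phi j (x : borel X) : R[i] := (rho j x `^ p^-1)%:C%C.
have mphi j : multiplier (phi j).
  by apply: (multiplier_powR_partition rhoP); rewrite invr_ge0 ltW.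
pose ind s k (x : borel X) : R[i] := (\1_(V s k) x : R)%:C%C.
have mind s k : multiplier (ind s k) by exact: multiplier_indic.
have ind_le1 s k x : normc (ind s k x) <= 1.
  by rewrite normc_real indicE; case: (_ \in _); rewrite ?normr0 ?normr1.
have indM s k x : ind s k x * ind s k x = ind s k x.
  by rewrite /ind indicE; case: (_ \in _); rewrite ?mulr0 ?mulr1.
pose psi k j (x : borel X) : R[i] := phi j x - phi j (c k).
have mpsi k j : multiplier (psi k j).
  by apply: multiplierD => //; exact: multiplier_cst.
(* On the k-th ball, [B, phi_j] u = B (psi u) - psi (B u), and B only sees the
   enlarged ball *)
have local_norm k j : `|mulop (ind r0 k) (commutator B (mulop (phi j)) u)| `^ p
  <= 2 `^ p * (b `^ p * `|mulop (fun x => ind (r0 + r) k x * psi k j x)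
                            (mulop (ind (r0 + r) k) u)| `^ p
     + `|mulop (fun x => ind r0 k x * psi k j x) (mulop (ind r0 k) (B u))| `^ p).
  set C := mulop _ (commutator _ _ _).
  have CE : C = mulop (ind r0 k) (B (mulop (ind (r0 + r) k) (mulop (psi k j) u)))
      - mulop (ind r0 k) (mulop (psi k j) (B u)).
    have phiE w : mulop (phi j) w = mulop (psi k j) w + phi j (c k) *: w.
      rewrite -mulop_cst -mulopDl//; last exact: multiplier_cst.
      by congr mulop; apply/funext => x; rewrite /psi subrK.
    have BphiE : commutator B (mulop (phi j)) u =
        B (mulop (psi k j) u) - mulop (psi k j) (B u).
      rewrite /commutator/= !phiE linearD linearZ/= opprD addrACA.
      by rewrite subrr addr0.
    rewrite /C BphiE mulopBr//; congr (_ - _).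
    set w := mulop (psi k j) u.
    (* the part of w outside the enlarged ball is too far away to be seen *)
    rewrite -[in LHS](mulop_indicD_setC w (mV (r0 + r) k)) linearD mulopDr//.
    rewrite [X in _ + X](_ : _ = 0) ?addr0//.
    apply: Bloc => [||x y xV [Dk yk]] //; first exact: measurableC.
    rewrite leNgt; apply/negP => xy; apply: xV; split=> //.
    apply: (le_lt_trans (metric_triangle _ y _)).
    by rewrite metric_sym in xy; apply: ltrD.
  have absorb s w : mulop (fun x => ind s k x * psi k j x) (mulop (ind s k) w)
      = mulop (ind s k) (mulop (psi k j) w).
    rewrite !mulopM//; last exact: multiplierM.
    by congr mulop; apply/funext => x; rewrite mulrAC indM.
  rewrite !absorb.
  rewrite CE; apply: (@le_trans _ _ ((b * `|mulop (ind (r0 + r) k) (mulop (psi k j) u)|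
     + `|mulop (ind r0 k) (mulop (psi k j) (B u))|) `^ p)).
    apply: ge0_ler_powR; rewrite ?nnegrE ?(ltW p0)// ?addr_ge0 ?mulr_ge0//.
    apply: (le_trans (ler_normB _ _)); rewrite lerD2r.
    by apply: (le_trans (norm_mulop_le _ (mind _ _) (ind_le1 _ _))).
  apply: (le_trans (powRD_le (ltW p0) _ _)); rewrite ?mulr_ge0//.
  by rewrite powRM.

(* every point of the enlarged ball is within 1 / t of its centre *)
have variation s k n (w : L) : s <= r0 + r ->
  \sum_(j < n) `|mulop (fun x => ind s k x * psi k j x) w| `^ p <= t * `|w| `^ p.
  move=> sr.
  apply: (@sum_normX_mulop_le _ _ _ _ _ _ (fun j x => ind s k x * psi k j x)).
    by move=> j; exact: multiplierM.
  move=> x.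
  have [[Dk xk]|xk] := pselect (V s k x); last first.
    rewrite big1 ?(ltW t0)// => j _.
    by rewrite /ind indicE memNset// mul0r normc0 powR0 ?gt_eqF.
  have xkt : mdist x (c k) <= t^-1.
    rewrite metric_sym (le_trans (ltW xk))// (le_trans sr)//.
    by rewrite -[r0 + r]invrK lef_pV2 ?posrE ?invr_gt0.
  apply: le_trans (root_partition_variation p1 rhoP n xkt).
  apply: ler_sum => j _; rewrite /ind indicE mem_set// mul1r.
  by rewrite /psi /phi -rmorphB normc_real.
apply: nneseries_ub => [j|n]; first exact: powR_ge0.
apply: (@le_trans _ _ (\sum_(k <oo) (\sum_(j < n)
    `|mulop (ind r0 k) (commutator B (mulop (phi j)) u)| `^ p)%:E)%E).
  under eq_eseriesr do rewrite -sumEFin.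
  rewrite nneseries_sum; last by move=> j k _; rewrite lee_fin powR_ge0.
  rewrite -sumEFin; apply: lee_sum => j _.
  apply: series_normX_mulop_ge => // x.
  have [k Dk kx] := cov x; exists k.
  by rewrite /ind normc_real indicE mem_set// normr1.
apply: nneseries_ub => [k|m].
  by apply: sumr_ge0 => j _; exact: powR_ge0.
rewrite lee_fin.
apply: (@le_trans _ _ (\sum_(k < m) 2 `^ p * (b `^ p * (t * `|mulop (ind (r0 + r) k) u| `^ p)
     + t * `|mulop (ind r0 k) (B u)| `^ p))).
  apply: ler_sum => k _.
  apply: le_trans; first by apply: ler_sum => j _; exact: local_norm.
  rewrite -mulr_sumr ler_wpM2l ?powR_ge0// big_split/= -mulr_sumr.
  apply: lerD; last by apply: variation; rewrite lerDl.
  by rewrite ler_wpM2l ?powR_ge0//; exact: variation.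
rewrite -mulr_sumr big_split/=.
rewrite -[X in _ * (X + _)]mulr_sumr -[X in _ * (_ * X + _)]mulr_sumr.
rewrite -[X in _ * (_ + X)]mulr_sumr.
have S1 := sum_normX_mulop_le u (mind (r0 + r)) (M1P ^~ m).
have S2 := sum_normX_mulop_le (B u) (mind r0) (M2P ^~ m).
have {}S2 : \sum_(k < m) `|mulop (ind r0 k) (B u)| `^ p <= M2 * b `^ p * `|u| `^ p.
  apply: (le_trans S2); rewrite -mulrA -powRM// ler_wpM2l//.
  by apply: ge0_ler_powR; rewrite ?nnegrE ?mulr_ge0 ?(ltW p0).
rewrite /K -!mulrA ler_wpM2l ?powR_ge0//.
rewrite mulrDl; apply: lerD.
- rewrite -mulrA ler_wpM2l ?powR_ge0// mulrCA ler_wpM2l ?(ltW t0)//.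
- by rewrite mulrCA ler_wpM2l ?(ltW t0)// mulrA.
Qed.

End band_operators.

(** * Gluing along a locally finite partition of unity *)

Section gluing.
Context d (T : measurableType d) (R : realType).
Variables (mu : {measure set T -> \bar R}) (p : R) (p_gt1 : 1 < p).
Local Open Scope quotient_scope.
Local Notation p1 := (ltW p_gt1).
Local Notation L := (cLp mu p1).
Variables (w : nat -> T -> R) (N : T -> nat).
Hypothesis mw : forall j, measurable_fun [set: T] (w j).
Hypothesis w0 : forall j x, 0 <= w j x.
Hypothesis w_sum : forall n x, \sum_(j < n) w j x <= 1.
Hypothesis w_vanish : forall x j, (N x <= j)%N -> w j x = 0.
Implicit Types h g : nat -> L.

Let p0 : 0 < p. Proof. exact: lt_trans p_gt1. Qed.
Let q0 : 0 < 1 - p^-1. Proof. by rewrite subr_gt0 invf_lt1. Qed.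

(** The sum of w_j ^ (1 - 1/p) h_j over all j. The sum is finite at each point,
    and its number of terms [N] depends on the weights only, not on [h]: this
    makes the construction linear without any convergence in the norm. *)
Definition glue_partial h n (x : T) : R[i] :=
  \sum_(j < n) (w j x `^ (1 - p^-1))%:C%C * repr (h j) x.

Definition glue_fun h (x : T) : R[i] := glue_partial h (N x) x.

(** For a family [h] whose norms are not p-summable, [glue h] may be the junk
    value 0. *)
Definition glue h : L := \pi_L (insubd (0 : cLfunType mu p1) (glue_fun h)).

Let glue_partial_stationary h n x : (N x <= n)%N ->
  glue_partial h n x = glue_fun h x.
Proof.
move=> /subnK <-; rewrite /glue_partial; elim: (n - _)%N => [//|m IHm].
rewrite addSn big_ord_recr/= IHm w_vanish ?leq_addl//.
by rewrite powR0 ?gt_eqF// mul0r addr0.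
Qed.

Let measurable_glue_partial h n : measurable_cfun (glue_partial h n).
Proof.
elim: n => [|n IHn].
  rewrite (_ : glue_partial h 0 = cst 0); first exact: measurable_cfun_cst.
  by apply/funext => x; rewrite /glue_partial big_ord0.
rewrite (_ : glue_partial h n.+1 = glue_partial h n +
  (fun x => (w n x `^ (1 - p^-1))%:C%C * repr (h n) x)); last first.
  by apply/funext => x; rewrite /glue_partial big_ord_recr.
apply: measurable_cfunD => //; apply: measurable_cfunM; last exact: measurable_repr.
split => /=; last exact: measurable_cst.
apply: (@measurableT_comp _ _ _ _ _ _ (fun y : R => y `^ (1 - p^-1))) => //.
Qed.

Let measurable_glue_fun h : measurable_cfun (glue_fun h).
Proof.
split.
- apply: (@measurable_fun_cvg _ _ _ _ (fun n x => complex.Re (glue_partial h n x))).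
    by move=> n; case: (measurable_glue_partial h n).
  move=> x _; apply: cvg_near_cst; exists (N x) => // n /= Nn.
  by rewrite glue_partial_stationary.
- apply: (@measurable_fun_cvg _ _ _ _ (fun n x => complex.Im (glue_partial h n x))).
    by move=> n; case: (measurable_glue_partial h n).
  move=> x _; apply: cvg_near_cst; exists (N x) => // n /= Nn.
  by rewrite glue_partial_stationary.
Qed.

Let normcX_glue_fun_le h x : (((normc (glue_fun h x)) `^ p)%:E <=
  \sum_(j <oo) (normc (repr (h j) x) `^ p)%:E)%E.
Proof.
apply: le_trans (@nneseries_lb _ (fun j => normc (repr (h j) x) `^ p) (N x) _); last first.
  by move=> j; exact: powR_ge0.
rewrite lee_fin.
apply: le_trans (weighted_hoelder p_gt1 _ _ (w_sum (N x) x)) => //; last first.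
  by move=> j; exact: normc_ge0.
have nc : normc (glue_fun h x) <=
    \sum_(j < N x) w j x `^ (1 - p^-1) * normc (repr (h j) x).
  rewrite /glue_fun /glue_partial.
  elim: (N x) => [|n IHn]; first by rewrite !big_ord0 normc0.
  rewrite !big_ord_recr/=; apply: (le_trans (le_normcD _ _)); apply: lerD => //.
  by rewrite normcM normc_real ger0_norm ?powR_ge0.
apply: ge0_ler_powR; rewrite ?nnegrE ?normc_ge0 ?(ltW p0)//.
exact: le_trans (normc_ge0 _) nc.
Qed.

Let integral_glue_fun_le h : (\int[mu]_x (normc (glue_fun h x) `^ p)%:E <=
  \sum_(j <oo) (`|h j| `^ p)%:E)%E.
Proof.
under eq_eseriesr do rewrite cLp_normX.
rewrite -integral_nneseries//; last 2 first.
- by move=> j; exact/measurable_normcX/measurable_repr.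
- by move=> j x _; rewrite lee_fin powR_ge0.
apply: ge0_le_integral => //.
- by move=> x _; rewrite lee_fin powR_ge0.
- exact: measurable_normcX.
- apply: ge0_emeasurable_sum => j; last by move=> _; exact/measurable_normcX/measurable_repr.
  by move=> x _ _; rewrite lee_fin powR_ge0.
Qed.

Lemma repr_glue h : (\sum_(j <oo) (`|h j| `^ p)%:E < +oo)%E ->
  {ae mu, forall x, repr (glue h) x = glue_fun h x}.
Proof.
move=> hoo; have glueL : glue_fun h \in cLfun mu p1.
  apply/cLfunP; split=> //.
  apply: (@lty_poweRy _ _ p); first by rewrite gt_eqF.
  rewrite /cLnorm poweR_Lnorm; last by rewrite gt_eqF.
  apply: le_lt_trans hoo; apply: le_trans (integral_glue_fun_le h).
  rewrite le_eqVlt; apply/orP; left; apply/eqP.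
  by apply: eq_integral => x _; rewrite poweR_EFin ger0_norm ?normc_ge0.
have := repr_piE (insubd (0 : cLfunType mu p1) (glue_fun h)).
by rewrite -[X in {ae mu, forall x, _ = X x}]/(\val _) insubdK.
Qed.

(** Gluing is a contraction from l^p families in L^p to L^p: Hoelder's inequality
    at each point, integrated. *)
Lemma normX_glue_le h : (\sum_(j <oo) (`|h j| `^ p)%:E < +oo)%E ->
  ((`|glue h| `^ p)%:E <= \sum_(j <oo) (`|h j| `^ p)%:E)%E.
Proof.
move=> /repr_glue/cLp_normX_ae => /(_ (measurable_glue_fun h)) ->.
exact: integral_glue_fun_le.
Qed.

Lemma glue_linear h (a : R[i]) g :
  (\sum_(j <oo) (`|h j| `^ p)%:E < +oo)%E ->
  (\sum_(j <oo) (`|g j| `^ p)%:E < +oo)%E ->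
  (\sum_(j <oo) (`|(a *: h j + g j)%R| `^ p)%:E < +oo)%E ->
  glue (fun j => a *: h j + g j) = a *: glue h + glue g.
Proof.
move=> hoo goo hgoo; apply: cLp_ext; near=> x.
have -> : repr (glue (fun j => a *: h j + g j)) x = glue_fun (fun j => a *: h j + g j) x.
  by near: x; exact: repr_glue.
have -> : repr (a *: glue h + glue g) x = repr (a *: glue h) x + repr (glue g) x.
  by near: x; exact: cLp_reprD.
have -> : repr (a *: glue h) x = a * repr (glue h) x by near: x; exact: cLp_reprZ.
have -> : repr (glue h) x = glue_fun h x by near: x; exact: repr_glue hoo.
have -> : repr (glue g) x = glue_fun g x by near: x; exact: repr_glue goo.
have hgE j : repr (a *: h j + g j) x = a * repr (h j) x + repr (g j) x.
  have -> : repr (a *: h j + g j) x = repr (a *: h j) x + repr (g j) x.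
    by move: j; near: x; apply: ae_foralln => j; exact: cLp_reprD.
  congr (_ + _).
  by move: j; near: x; apply: ae_foralln => j; exact: cLp_reprZ.
rewrite /glue_fun /glue_partial mulr_sumr -big_split/=; apply: eq_bigr => j _.
by rewrite hgE mulrDr mulrCA.
Unshelve. all: by end_near. Qed.

End gluing.

(** * Approximation by band operators *)

Section commutator_series.
Context {R : realType} {X : pmetricType R}.
Variables (mu : {measure set (borel X) -> \bar R}) (p : R) (p1 : 1 <= p).
Variables (t : R) (rho : nat -> X -> R).
Hypothesis rhoP : A'_family t rho.
Local Notation L := (cLp mu p1).
Local Notation M j := (mulop (fun x : borel X => (rho j x `^ p^-1)%:C%C)).
Implicit Types u : L.

Let p0 : 0 < p. Proof. exact: lt_le_trans p1. Qed.

Lemma multiplier_root_partition j :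
  multiplier (fun x : borel X => (rho j x `^ p^-1)%:C%C).
Proof. by apply: (multiplier_powR_partition rhoP); rewrite invr_ge0 ltW. Qed.

Lemma sum_normX_root_partition_le n u :
  \sum_(j < n) `|(M j u : L)| `^ p <= `|u| `^ p.
Proof.
rewrite -[leRHS]mul1r.
apply: (@sum_normX_mulop_le _ _ _ _ _ p1 (fun j (x : borel X) => (rho j x `^ p^-1)%:C%C)).
  exact: multiplier_root_partition.
exact: (sum_normcX_root_partition p1 rhoP).
Qed.

Lemma sum_normX_operator_partition_le (A : L -> L) (b : R) n u : 0 <= b ->
  (forall v, `|A v| <= b * `|v|) ->
  \sum_(j < n) `|A (M j u)| `^ p <= b `^ p * `|u| `^ p.
Proof.
move=> b0 Ab.
apply: (@le_trans _ _ (\sum_(j < n) b `^ p * `|(M j u : L)| `^ p)).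
  apply: ler_sum => j _; rewrite -powRM//.
  by apply: ge0_ler_powR; rewrite ?nnegrE ?mulr_ge0 ?(ltW p0).
rewrite -mulr_sumr ler_wpM2l ?powR_ge0//.
exact: sum_normX_root_partition_le.
Qed.

Lemma series_normX_operator_partition_le (A : L -> L) (b : R) u : 0 <= b ->
  (forall v, `|A v| <= b * `|v|) ->
  (\sum_(j <oo) (`|A (M j u)| `^ p)%:E <= (b `^ p * `|u| `^ p)%:E)%E.
Proof.
move=> b0 Ab; apply: nneseries_ub => [j|n]; first exact: powR_ge0.
by rewrite lee_fin; exact: sum_normX_operator_partition_le.
Qed.

Lemma series_normX_partition_le u :
  (\sum_(j <oo) (`|(M j u : L)| `^ p)%:E <= (`|u| `^ p)%:E)%E.
Proof.
apply: nneseries_ub => [j|n]; first exact: powR_ge0.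
by rewrite lee_fin; exact: sum_normX_root_partition_le.
Qed.

(** Since the p-th powers of the roots of a partition of unity sum to 1, the
    commutators of any bounded operator are p-summable, with a bound
    proportional to the p-th power of its norm; hence operators of small norm
    contribute little. *)
Lemma commutator_series_le (A : L -> L) (b : R) u : 0 <= b ->
  (forall v, `|A v| <= b * `|v|) ->
  (\sum_(j <oo) (`|commutator A (M j) u| `^ p)%:E <=
   (2 `^ p * (2 * b `^ p) * `|u| `^ p)%:E)%E.
Proof.
move=> b0 Ab; apply: nneseries_ub => [j|n]; first exact: powR_ge0.
rewrite lee_fin.
apply: (@le_trans _ _ (\sum_(j < n) 2 `^ p * (`|A (M j u)| `^ p + `|(M j (A u) : L)| `^ p))).
  apply: ler_sum => j _.
  apply: le_trans (powRD_le (ltW p0) (normr_ge0 _) (normr_ge0 _)).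
  by apply: ge0_ler_powR; rewrite ?nnegrE ?addr_ge0 ?(ltW p0)// ler_normB.
rewrite -mulr_sumr -mulrA ler_wpM2l ?powR_ge0// big_split/= mulr2n mulrDl mul1r mulrDl.
apply: lerD; first exact: sum_normX_operator_partition_le.
apply: (le_trans (sum_normX_root_partition_le _ _)).
rewrite -powRM//.
by apply: ge0_ler_powR; rewrite ?nnegrE ?mulr_ge0 ?(ltW p0).
Qed.

End commutator_series.

Lemma linear_of (K : pzRingType) (U V : lmodType K) (f : U -> V) :
  linear f -> exists F : {linear U -> V}, F = f :> (U -> V).
Proof.
move=> lf.
pose F : {linear U -> V} := HB.pack f (GRing.isLinear.Build K U V *:%R f lf).
by exists F.
Qed.

Section band_approximation.
Context {R : realType} {X : pmetricType R}.
Variables (mu : {measure set (borel X) -> \bar R}) (p : R) (p_gt1 : 1 < p).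
Variables (t : R) (rho : nat -> X -> R).
Hypothesis rhoP : A'_family t rho.
Local Notation p1 := (ltW p_gt1).
Local Notation L := (cLp mu p1).
Local Notation M j := (mulop (fun x : borel X => (rho j x `^ p^-1)%:C%C)).
Implicit Types u : L.

Let p0 : 0 < p. Proof. exact: lt_trans p_gt1. Qed.

Lemma A'_vanish : exists N : X -> nat, forall x j, (N x <= j)%N -> rho j x = 0.
Proof.
suff /choice[N NP] : forall x, exists n, forall j, (n <= j)%N -> rho j x = 0.
  by exists N.
move=> x; have := A'_locally_finite rhoP x ltr01.
move=> /finite_seqP[F FE]; exists (\max_(i <- F) i).+1 => j Fj.
apply/eqP; apply: contraTT Fj => rj; rewrite -leqNgt.
have jF : j \in F.
  have : [set` F] j.
    rewrite -FE; exists x; split; last exact: ballxx.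
    exact: subset_closure.
  by [].
by rewrite (big_rem j)//= leq_maxl.
Qed.

Lemma A'_diam_bound : exists2 D : R, 0 <= D &
  forall j x y, rho j x != 0 -> rho j y != 0 -> mdist x y <= D.
Proof.
have dge0 := nneg_sup_ge0 [set diam (spt (rho j)) | j in [set: nat]].
have : nneg_sup [set diam (spt (rho j)) | j in [set: nat]] \is a fin_num.
  by rewrite ge0_fin_numE//; exact: A'_diam rhoP.
move=> /fineK dE; exists (fine (nneg_sup [set diam (spt (rho j)) | j in [set: nat]])).
  by rewrite fine_ge0.
move=> j x y jx jy; rewrite -lee_fin dE.
apply: (@le_trans _ _ (diam (spt (rho j)))); last by apply: nneg_sup_ub; exists j.
by apply: nneg_sup_ub; exists (x, y) => //; split; exact: subset_closure.
Qed.

(** The operator S u = sum of phi_j ^ (p - 1) A (phi_j u) has propagation at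
    most the bound on the diameters of the supports. As the products
    phi_j ^ (p - 1) phi_j = rho_j sum to 1, A u is the gluing of the family
    phi_j (A u), so A u - S u is the gluing of - [A, phi_j] u, and gluing is a
    contraction. *)
Lemma band_approximation (A : {linear L -> L}) : bounded_operator A ->
  exists2 S : {linear L -> L}, BO S & forall u,
    ((`|A u - S u| `^ p)%:E <= \sum_(j <oo) (`|commutator A (M j) u| `^ p)%:E)%E.
Proof.
move=> /bounded_operatorP[b b0 Ab].
have [N NP] := A'_vanish.
have [D D0 DP] := A'_diam_bound.
have mw : forall j, measurable_fun [set: borel X] (rho j) := A'_measurable rhoP.
have w0 := A'_ge0 rhoP.
have w1 := A'_psum_le1 rhoP.
have wN x : \sum_(j < N x) rho j x = 1.
  apply: EFin_inj; rewrite -(A'_sum1 rhoP x) -sumEFin; apply/esym.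
  apply: lim_near_cst => //; exists (N x) => // n /= /subnK <-.
  elim: (n - N x)%N => [|m IHm]; first by rewrite big_mkord.
  by rewrite addSn big_nat_recr//= IHm NP ?leq_addl// adde0.
pose G : (nat -> L) -> L := @glue _ (borel X) R mu p p_gt1 rho N.
have mM j := multiplier_root_partition p1 rhoP j.
have Asum u := series_normX_operator_partition_le rhoP u b0 Ab.
have Gsum u : (\sum_(j <oo) (`|A (M j u)| `^ p)%:E < +oo)%E.
  by apply: le_lt_trans (Asum u) (ltry _).
have linS : linear (fun u => G (fun j => A (M j u))).
  move=> a u v; have AM j : A (M j (a *: u + v)) = a *: A (M j u) + A (M j v).
    by rewrite mulopDr// mulopZr// linearP.
  rewrite -glue_linear//; first by congr G; apply/funext => j.
  by under eq_eseriesr do rewrite -AM.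
have [S SE] := linear_of linS; exists S.
  split.
    apply/bounded_operatorP; exists b => // u.
    apply: (ler_powR_inv p0) => //; first by rewrite mulr_ge0.
    rewrite powRM// -lee_fin SE; apply: le_trans (normX_glue_le mw w0 w1 NP (Gsum u)) _.
    exact: Asum.
  apply: (@le_lt_trans _ _ D%:E); last exact: ltry.
  apply/nneg_sup_le; split; first by rewrite lee_fin.
  move=> _ [K [K' [mK mK' SK ->]]]; rewrite leNgt; apply/negP => DK.
  apply: SK; apply/funext => u /=; rewrite SE; apply: cLp_ext.
  set h := fun j => A (M j (mulop_indic K u)).
  (* a support meeting K' cannot meet K *)
  have h0 j x : K' x -> rho j x != 0 -> h j = 0.
    move=> K'x jx; rewrite /h mulopM//; last exact: multiplier_indic.
    rewrite mulop_eq0 ?linear0// => y.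
    have [Ky|Ky] := pselect (K y); last by rewrite indicE memNset// mulr0.
    have [->|jy] := eqVneq (rho j y) 0.
      by rewrite powR0 ?mul0r// invr_eq0 gt_eqF.
    exfalso; move: DK; rewrite ltNge => /negP; apply.
    apply: (@le_trans _ _ (mdist y x)%:E); last by rewrite lee_fin (DP j).
    by apply: ereal_inf_lbound; exists (y, x).
  near=> x.
  have -> : repr (0 : L) x = 0 by near: x; exact: cLp_repr0.
  have -> : repr (mulop_indic K' (G h)) x = (\1_K' x)%:C%C * repr (G h) x.
    by near: x; apply: repr_mulop; exact: multiplier_indic.
  have -> : repr (G h) x = glue_fun (rho : nat -> borel X -> R) N h x.
    by near: x; apply: repr_glue => //; exact: Gsum.
  have hx j : h j = 0 -> repr (h j) x = 0.
    move: j; near: x; apply: ae_foralln => j.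
    have [hj0|hj0] := pselect (h j = 0); last by apply: aeW => x /hj0.
    by have := @cLp_repr0 _ _ _ mu p p1; apply: filterS => y; rewrite hj0.
  have [K'x|K'x] := pselect (K' x); last by rewrite indicE memNset// mul0r.
  rewrite /glue_fun /glue_partial big1 ?mulr0// => j _.
  have [->|jx] := eqVneq (rho j x) 0; last by rewrite hx ?mulr0//; exact: h0 jx.
  by rewrite powR0 ?mul0r// subr_eq0 eq_sym invr_eq1 gt_eqF.
move=> u; rewrite SE.
have Msum : (\sum_(j <oo) (`|(M j (A u) : L)| `^ p)%:E < +oo)%E.
  by apply: le_lt_trans (series_normX_partition_le rhoP (A u)) (ltry _).
have AuE : A u = G (fun j => M j (A u)).
  apply: cLp_ext; near=> x.
  have -> : repr (G (fun j => M j (A u))) x =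
      glue_fun (rho : nat -> borel X -> R) N (fun j => M j (A u)) x.
    by near: x; apply: repr_glue => //; exact: Msum.
  have Mx j : repr (M j (A u)) x = (rho j x `^ p^-1)%:C%C * repr (A u) x.
    by move: j; near: x; apply: ae_foralln => j; exact: repr_mulop.
  rewrite /glue_fun /glue_partial; under eq_bigr do rewrite Mx mulrA -rmorphM/=.
  rewrite -mulr_suml -rmorph_sum/= -[LHS]mul1r; congr (_%:C%C * _).
  transitivity (\sum_(j < N x) rho j x); first by rewrite wN.
  apply: eq_bigr => j _.
  have := @powRD _ (rho j x) (1 - p^-1) p^-1.
  by rewrite subrK oner_eq0 powRr1 ?w0//= => /(_ isT).
have comE j : (-1) *: A (M j u) + M j (A u) = - commutator A (M j) u.
  by rewrite scaleN1r /commutator/= opprB addrC.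
have comsum : (\sum_(j <oo) (`|(-1) *: A (M j u) + (M j (A u) : L)| `^ p)%:E < +oo)%E.
  under eq_eseriesr do rewrite comE normrN.
  by apply: le_lt_trans (commutator_series_le rhoP u b0 Ab) (ltry _).
have -> : A u - G (fun j => A (M j u)) = G (fun j => (-1) *: A (M j u) + M j (A u)).
  by rewrite [in LHS]AuE /G (glue_linear mw w0 w1 NP (Gsum u) Msum comsum) scaleN1r addrC.
apply: le_trans (normX_glue_le mw w0 w1 NP comsum) _.
by under eq_eseriesr do rewrite comE normrN.
Unshelve. all: by end_near. Qed.

End band_approximation.

(** * The equivalence *)

Lemma ereal_cvg0_at_rightP {R : realType} (F : R -> \bar R) : (forall t, (0 <= F t)%E) ->
  F t @[t --> 0^'+] --> 0%E <->
  forall e : R, 0 < e -> \forall t \near 0^'+, (F t <= e%:E)%E.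
Proof.
move=> F0; split=> [/fine_cvgP[Ffin /cvgrPdist_le F0'] e e0|Fe].
  near=> t; have Ft : F t \is a fin_num by near: t.
  rewrite -(fineK Ft) lee_fin.
  have : `|0 - fine (F t)| <= e by near: t; exact: F0'.
  by rewrite sub0r normrN ger0_norm// fine_ge0.
have fin1 : \forall t \near 0^'+, F t \is a fin_num.
  near=> t; rewrite ge0_fin_numE//; apply: (@le_lt_trans _ _ 1%:E); last exact: ltry.
  by near: t; exact: Fe.
apply/fine_cvgP; split=> //; apply/cvgrPdist_le => e e0; near=> t.
have Ft : F t \is a fin_num by near: t.
rewrite sub0r normrN /= ger0_norm ?fine_ge0// -lee_fin fineK//.
by near: t; exact: Fe.
Unshelve. all: by end_near. Qed.

Theorem proposition3p5 (R : realType) (X : pmetricType R)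
    (X_proper : proper_space X) (X_bg : bounded_geometry X)
    (X_A' : property_A' X)
    (mu : {measure set (borel X) -> \bar R})
    (p : R) (p_gt1 : 1 < p)
    (rho : R -> nat -> X -> R)
    (rhoP : forall t : R, 0 < t -> A'_family t (rho t))
    (A : {linear cLp mu (ltW p_gt1) -> cLp mu (ltW p_gt1)})
    (A_bounded : bounded_operator A) :
  let phi (t : R) (j : nat) (x : X) : R := rho t j x `^ p^-1 in
  let M (t : R) (j : nat) : cLp mu (ltW p_gt1) -> cLp mu (ltW p_gt1) :=
    mulop (fun x : borel X => (phi t j x)%:C%C) in
  BDO A <->
  nneg_sup [set (\sum_(j <oo) (`|commutator A (M t j) f| `^ p)%:E)%E
       | f in [set f | `|f| = 1]] @[t --> 0^'+] --> 0%E.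
Proof.
move=> phi M.
have p0 : 0 < p := lt_trans ltr01 p_gt1.
have p1 : 1 <= p := ltW p_gt1.
rewrite ereal_cvg0_at_rightP; last by move=> t; exact: nneg_sup_ge0.
have two0 : 0 < 2 `^ p :> R by exact: powR_gt0.
split=> [[_ approx] e e0|small].
- (* c * delta ^ p bounds the contribution of A - B; one of the factors 2 ^ p
     comes from splitting A into A - B and B *)
  pose c := 2 `^ p * (2 `^ p * 2) : R.
  have c0 : 0 < c by rewrite !mulr_gt0.
  pose delta := (e / 2 / c) `^ p^-1.
  have e2c : 0 < e / 2 / c by rewrite !divr_gt0.
  have delta0 : 0 < delta by exact: powR_gt0.
  have deltaE : c * delta `^ p = e / 2.
    rewrite /delta -powRrM mulVf ?gt_eqF// powRr1 ?(ltW e2c)//.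
    by rewrite mulrC divfK// gt_eqF.
  have [B BB AB] := approx _ delta0.
  have [_ ABle] : 0 <= delta /\ forall u, `|(A \- B)%R u| <= delta * `|u|.
    by apply/opnorm_leP; exact: ltW.
  have [K [t0 [K0 t0_gt0 BK]]] := BO_commutator_le X_bg BB.
  near=> t.
  have t_gt0 : 0 < t by near: t; exact: nbhs_right_gt.
  have tt0 : t <= t0 by near: t; exact: nbhs_right_le.
  have Kt : 2 `^ p * (K * t) <= e / 2.
    have : t <= e / 2 / (2 `^ p * (K + 1)).
      by near: t; apply: nbhs_right_le; rewrite !divr_gt0// mulr_gt0// ltr_wpDl.
    rewrite ler_pdivlMr; last by rewrite mulr_gt0// ltr_wpDl.
    apply: le_trans; rewrite [leRHS]mulrCA ler_wpM2l ?powR_ge0//.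
    by rewrite mulrC ler_wpM2l ?(ltW t_gt0)// lerDl.
  have rhot := rhoP _ t_gt0.
  apply/nneg_sup_le; split; first by rewrite lee_fin ltW.
  move=> _ [u /= u1 <-].
  have mM j := multiplier_root_partition p1 rhot j.
  have sumB := BK _ _ t_gt0 tt0 rhot u.
  have sumAB := commutator_series_le rhot u (ltW delta0) ABle.
  rewrite u1 powR1 mulr1 in sumB; rewrite u1 powR1 mulr1 in sumAB.
  apply: nneseries_ub => [j|n]; first exact: powR_ge0.
  rewrite lee_fin; apply: (@le_trans _ _ (\sum_(j < n) 2 `^ p *
    (`|commutator (A \- B)%R (M t j) u| `^ p + `|commutator B (M t j) u| `^ p))).
    apply: ler_sum => j _.
    apply: le_trans (powRD_le (ltW p0) (normr_ge0 _) (normr_ge0 _)).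
    apply: ge0_ler_powR; rewrite ?nnegrE ?addr_ge0 ?(ltW p0)//.
    suff -> : commutator A (M t j) u =
        commutator (A \- B)%R (M t j) u + commutator B (M t j) u.
      exact: ler_normD.
    rewrite /commutator/= /M (mulopBr _ _ (mM j)) opprB -addrA.
    by rewrite [X in _ = _ + X]addrC !subrKA.
  rewrite -mulr_sumr big_split/=.
  apply: (@le_trans _ _ (2 `^ p * (2 `^ p * (2 * delta `^ p) + K * t))).
    rewrite ler_wpM2l ?powR_ge0//; apply: lerD; rewrite -lee_fin.
      by apply: le_trans sumAB; apply: nneseries_lb => j; exact: powR_ge0.
    by apply: le_trans sumB; apply: nneseries_lb => j; exact: powR_ge0.
  rewrite mulrDr [leRHS](splitr e); apply: lerD => //.
  by rewrite -deltaE /c !mulrA.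
- split=> // e e0.
  have e20 : 0 < e / 2 by rewrite divr_gt0.
  pose F t := nneg_sup [set (\sum_(j <oo) (`|commutator A (M t j) f| `^ p)%:E)%E
       | f in [set f | `|f| = 1]].
  have [t t_gt0 Ft] : exists2 t, 0 < t & (F t <= ((e / 2) `^ p)%:E)%E.
    have Fe := small _ (powR_gt0 p e20).
    near (0 : R)^'+ => t; exists t; first by near: t; exact: nbhs_right_gt.
    by near: t.
  have [S SBO AS] := band_approximation (rhoP _ t_gt0) A_bounded.
  exists S => //; apply: (@le_lt_trans _ _ (e / 2)%:E); last first.
    by rewrite lte_fin ltr_pdivrMr// ltr_pMr// ltr1n.
  apply/opnorm_leP; split; first exact: ltW.
  apply: linear_unit_norm_le => u u1.
  apply: (ler_powR_inv p0) => //; first exact: ltW.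
  rewrite -lee_fin; apply: (le_trans (AS u)).
  by apply: le_trans Ft; apply: nneg_sup_ub; exists u.
Unshelve. all: by end_near. Qed.
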